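(* Let $S$ be a simple $\mathcal{R}$-module. Then the following statements are equivalent: (1) there exists $t\in\mathbb{Z}_+$ such that the action of $L_t$ on $S$ is locally finite; (2) $S$ is a smooth module; (3) $S$ is either a highest weight module, or isomorphic to the induced module $\mathrm{Ind}(V)=U(\mathcal{R})\otimes_{U(\mathfrak{b})}V$, where $V$ is a simple $\mathfrak{b}$-module for which there exists $t\in\mathbb{Z}_+$ such that the action of $L_t$ on $V$ is injective and $L_iV=0$ for all $i>t$ (equivalently, $V$ is a simple $\mathfrak{b}^{(t)}$-module for some $t\in\mathbb{Z}_+$, with $L_t$ acting injectively).
   Context: The Ramond algebra $\mathcal{R}=\mathcal{R}_{\bar 0}\oplus\mathcal{R}_{\bar 1}$ is the Lie superalgebra with basis $\{L_m,G_m,c\mid m\in\mathbb{Z}\}$, where $\mathcal{R}_{\bar 0}=\mathrm{span}\{L_m,c\}$, $\mathcal{R}_{\bar 1}=\mathrm{span}\{G_m\}$, and brackets $[L_m,L_n]=(m-n)L_{m+n}+\delta_{m+n,0}\frac{m^3-m}{12}c$, $[L_m,G_n]=(\frac m2-n)G_{m+n}$, $[G_m,G_n]=2L_{m+n}+\frac13\delta_{m+n,0}(m^2-\frac14)c$, $[\mathcal{R},c]=0$. Modules are $\mathbb{Z}_2$-graded (super)modules. $\mathfrak{b}=\bigoplus_{m\geq 0}(\mathbb{C}L_m\oplus\mathbb{C}G_m)\oplus\mathbb{C}c$; for $t\in\mathbb{N}$, $\mathfrak{m}^{(t)}=\bigoplus_{m>t}(\mathbb{C}L_m\oplus\mathbb{C}G_m)$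 is an ideal of $\mathfrak{b}$ and $\mathfrak{b}^{(t)}=\mathfrak{b}/\mathfrak{m}^{(t)}$. The action of $x$ on $S$ is locally finite if $\dim\sum_{n\in\mathbb{Z}_+}\mathbb{C}x^nv<\infty$ for all $v\in S$. With $\mathcal{R}_m=\mathrm{span}\{L_m,G_m,\delta_{m,0}c\}$, $S$ is smooth if for each $v\in S$ there is $n\in\mathbb{N}$ with $\mathcal{R}_mv=0$ for all $m>n$. With $\mathcal{R}_+=\mathrm{span}\{L_m,G_m\mid m>0\}$, a highest weight module is one generated by a nonzero $w$ with $\mathcal{R}_+w=0$, $L_0w=\lambda w$, $cw=lw$ for some $\lambda,l\in\mathbb{C}$. *)

(* Defs.v *)
From HB Require Import structures.
From mathcomp Require Import all_boot all_order all_algebra.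
From mathcomp Require Import reals complex.
Set Implicit Arguments. Unset Strict Implicit. Unset Printing Implicit Defensive.
Import Order.TTheory GRing.Theory Num.Theory.
Local Open Scope ring_scope.

(* Modules over the Ramond algebra R and over its subalgebra b, written out
   concretely: a Z2-graded F-vector space together with the operators by which
   the basis elements L_m, G_m, c act, satisfying the super-bracket relations
   (L_m, c even; G_m odd, so [G_m,G_n] = G_m G_n + G_n G_m). *)

Section RamondDefs.
Variable F : fieldType.

Definition subspace (V : lmodType F) (P : V -> Prop) : Prop :=
  P 0 /\ (forall (a : F) (u v : V), P u -> P v -> P (a *: u + v)).

Definition grading (V : lmodType F) (P0 P1 : V -> Prop) : Prop :=
  [/\ subspace P0, subspace P1,
      (forall v : V, exists v0 v1, [/\ P0 v0, P1 v1 & v = v0 + v1]) &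
      (forall v : V, P0 v -> P1 v -> v = 0)].

Definition delta0 (k : int) : F := (k == 0)%:R.

Definition cLL (m n : int) : F := ((m - n)%:~R).
Definition zLL (m n : int) : F := delta0 (m + n) * (((m ^+ 3 - m)%:~R) / 12%:R).
Definition cLG (m n : int) : F := (m%:~R / 2%:R - n%:~R).
Definition zGG (m n : int) : F :=
  delta0 (m + n) * (3%:R^-1 * ((m%:~R) ^+ 2 - 4%:R^-1)).

Record RMod := {
  rcar :> lmodType F;
  rev : rcar -> Prop;
  rod : rcar -> Prop;
  rL : int -> rcar -> rcar;
  rG : int -> rcar -> rcar;
  rc : rcar -> rcar;
  r_grading : grading rev rod;
  r_linL : forall m, linear (rL m);
  r_linG : forall m, linear (rG m);
  r_linc : linear rc;
  r_parL : forall m v, (rev v -> rev (rL m v)) /\ (rod v -> rod (rL m v));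
  r_parG : forall m v, (rev v -> rod (rG m v)) /\ (rod v -> rev (rG m v));
  r_parc : forall v, (rev v -> rev (rc v)) /\ (rod v -> rod (rc v));
  r_LL : forall m n v, rL m (rL n v) - rL n (rL m v)
           = cLL m n *: rL (m + n) v + zLL m n *: rc v;
  r_LG : forall m n v, rL m (rG n v) - rG n (rL m v) = cLG m n *: rG (m + n) v;
  r_GG : forall m n v, rG m (rG n v) + rG n (rG m v)
           = 2%:R *: rL (m + n) v + zGG m n *: rc v;
  r_cL : forall m v, rc (rL m v) = rL m (rc v);
  r_cG : forall m v, rc (rG m v) = rG m (rc v)
}.

Record BMod := {
  bcar :> lmodType F;
  bev : bcar -> Prop;
  bod : bcar -> Prop;
  bL : nat -> bcar -> bcar;
  bG : nat -> bcar -> bcar;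
  bc : bcar -> bcar;
  b_grading : grading bev bod;
  b_linL : forall m, linear (bL m);
  b_linG : forall m, linear (bG m);
  b_linc : linear bc;
  b_parL : forall m v, (bev v -> bev (bL m v)) /\ (bod v -> bod (bL m v));
  b_parG : forall m v, (bev v -> bod (bG m v)) /\ (bod v -> bev (bG m v));
  b_parc : forall v, (bev v -> bev (bc v)) /\ (bod v -> bod (bc v));
  b_LL : forall (m n : nat) v, bL m (bL n v) - bL n (bL m v)
           = cLL m n *: bL (m + n) v + zLL m n *: bc v;
  b_LG : forall (m n : nat) v, bL m (bG n v) - bG n (bL m v)
           = cLG m n *: bG (m + n) v;
  b_GG : forall (m n : nat) v, bG m (bG n v) + bG n (bG m v)
           = 2%:R *: bL (m + n) v + zGG m n *: bc v;
  b_cL : forall m v, bc (bL m v) = bL m (bc v);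
  b_cG : forall m v, bc (bG m v) = bG m (bc v)
}.

Arguments rev : clear implicits. Arguments rod : clear implicits.
Arguments rL : clear implicits. Arguments rG : clear implicits.
Arguments rc : clear implicits.
Arguments bev : clear implicits. Arguments bod : clear implicits.
Arguments bL : clear implicits. Arguments bG : clear implicits.
Arguments bc : clear implicits.

Section RModTheory.
Variable S : RMod.

Definition r_submodule (W : S -> Prop) : Prop :=
  [/\ subspace W,
      (forall m w, W w -> W (rL S m w) /\ W (rG S m w)),
      (forall w, W w -> W (rc S w)) &
      (forall w, W w -> exists w0 w1,
          [/\ rev S w0, rod S w1, W w0, W w1 & w = w0 + w1])].

Definition r_simple : Prop :=
  (exists v : S, v != 0) /\
  forall W, r_submodule W -> (forall w, W w -> w = 0) \/ (forall w, W w).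

Definition in_span (V : lmodType F) (s : seq V) (u : V) : Prop :=
  exists a : nat -> F, u = \sum_(i < size s) a i *: nth 0 s i.

Definition locally_finite (V : lmodType F) (x : V -> V) : Prop :=
  forall v : V, exists s : seq V, forall n : nat, (0 < n)%N -> in_span s (iter n x v).

Definition smooth : Prop :=
  forall v : S, exists n : nat, forall m : int, (n%:Z < m) ->
    [/\ rL S m v = 0, rG S m v = 0 & (m = 0 -> rc S v = 0)].

Definition generates (w : S) : Prop :=
  forall P : S -> Prop, subspace P ->
    (forall m u, P u -> P (rL S m u) /\ P (rG S m u)) ->
    (forall u, P u -> P (rc S u)) -> P w -> forall v, P v.

Definition highest_weight : Prop :=
  exists w : S, [/\ w != 0, generates w,
    (forall m : int, 0 < m -> rL S m w = 0 /\ rG S m w = 0) &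
    exists lam l : F, rL S 0 w = lam *: w /\ rc S w = l *: w].
End RModTheory.

Definition r_hom (M N : RMod) (f : M -> N) : Prop :=
  [/\ linear f,
      (forall v, (rev M v -> rev N (f v)) /\ (rod M v -> rod N (f v))),
      (forall m v, f (rL M m v) = rL N m (f v) /\ f (rG M m v) = rG N m (f v)) &
      (forall v, f (rc M v) = rc N (f v))].

Definition r_iso (M N : RMod) : Prop :=
  exists f : M -> N, r_hom f /\ bijective f.

Definition b_submodule (V : BMod) (W : V -> Prop) : Prop :=
  [/\ subspace W,
      (forall m w, W w -> W (bL V m w) /\ W (bG V m w)),
      (forall w, W w -> W (bc V w)) &
      (forall w, W w -> exists w0 w1,
          [/\ bev V w0, bod V w1, W w0, W w1 & w = w0 + w1])].

Definition b_simple (V : BMod) : Prop :=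
  (exists v : V, v != 0) /\
  forall W : V -> Prop, b_submodule W -> (forall w, W w -> w = 0) \/ (forall w, W w).

Definition b_hom (V : BMod) (N : RMod) (f : V -> N) : Prop :=
  [/\ linear f,
      (forall v, (bev V v -> rev N (f v)) /\ (bod V v -> rod N (f v))),
      (forall (m : nat) v, f (bL V m v) = rL N m (f v) /\ f (bG V m v) = rG N m (f v)) &
      (forall v, f (bc V v) = rc N (f v))].

(* (M, iota) is the induced module Ind(V) = U(R) (x)_{U(b)} V, characterised
   (up to isomorphism) by its universal property (Frobenius reciprocity). *)
Definition is_induced (V : BMod) (M : RMod) (iota : V -> M) : Prop :=
  b_hom iota /\
  forall (N : RMod) (f : V -> N), b_hom f ->
    exists g : M -> N, [/\ r_hom g, (forall v, g (iota v) = f v) &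
      forall g' : M -> N, r_hom g' -> (forall v, g' (iota v) = f v) ->
        forall x, g' x = g x].

End RamondDefs.

Arguments rev {F} r _. Arguments rod {F} r _.
Arguments rL {F} r _ _. Arguments rG {F} r _ _. Arguments rc {F} r _.
Arguments bev {F} b _. Arguments bod {F} b _.
Arguments bL {F} b _ _. Arguments bG {F} b _ _. Arguments bc {F} b _.

(* Main.v *)
Require Import Defs.
From HB Require Import structures.
From mathcomp Require Import all_boot all_order all_algebra.
From mathcomp Require Import reals complex.
From mathcomp Require Import ssrAC zify ring.
From mathcomp Require Import boolp classical_sets functions cardinality ereal lebesgue_measure.
Import Defs.
Set Implicit Arguments. Unset Strict Implicit. Unset Printing Implicit Defensive.
Import Order.TTheory GRing.Theory Num.Theory.
Local Open Scope ring_scope.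

(**
Local finiteness gives smoothness: an [L_t]-stable finite-dimensional space [Y] is mapped by all [X_m], [m > t]
([X = L] or [G]), into a finite-dimensional space, so some nonzero polynomial [f] gives a combination
[sum_j f_j X_(N+j)] that vanishes on a large enough such space for one [N]. Brackets with two [L_b]'s make it
vanish on [Y] for all large [N], and a bracket with [L_t] replaces [f] by its derivative; at degree [0] this says
that [X_N] kills [Y] for all large [N].

Conversely let [S] be smooth, and let [t] be minimal such that [V], the space killed by all [X_m] with [m > t],
is nonzero. If [t > 0] then [L_t] is injective on [V], and a filtration whose associated graded makes [L_(t+k)]
and [G_(t+k)] act as [L_t] times derivations shows that the ordered monomials in negative generators are
independent over [V]. Hence no induced module has to be constructed: [S] itself is [Ind(V)], a morphism [f] on
[V] being extended through the submodule of [S * N] generated by the graph of [f]. If [t = 0], then [c] is a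
scalar by Dixmier's argument (countable dimension over an uncountable field), and were [G_0] without eigenvector
on [V], the same independence, now with respect to the degree in [G_0], would contradict simplicity.

From highest weight or induced modules one returns to local finiteness because [S] is smooth and generated by a
vector killed by some [L_T], so that [L_T] is locally nilpotent.
*)


(** * Linear algebra with subspaces given as predicates *)

Section Subspaces.
Variables (F : fieldType) (V : lmodType F).
Implicit Types (P A : V -> Prop).

Lemma subspace0 P : subspace P -> P 0. Proof. by case. Qed.

Lemma subspaceZ P a u : subspace P -> P u -> P (a *: u).
Proof. by move=> [P0 PL] Pu; rewrite -[_ *: _]addr0; apply: PL. Qed.

Lemma subspaceD P u v : subspace P -> P u -> P v -> P (u + v).
Proof. by move=> [P0 PL] Pu Pv; rewrite -[u]scale1r; apply: PL. Qed.

Lemma subspaceN P u : subspace P -> P u -> P (- u).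
Proof. by move=> sP Pu; rewrite -scaleN1r; apply: subspaceZ. Qed.

Lemma subspaceB P u v : subspace P -> P u -> P v -> P (u - v).
Proof. by move=> sP Pu Pv; apply: subspaceD => //; apply: subspaceN. Qed.

Lemma subspace_sum P (I : Type) (r : seq I) (Q : pred I) (f : I -> V) :
  subspace P -> (forall i, Q i -> P (f i)) -> P (\sum_(i <- r | Q i) f i).
Proof.
move=> sP Pf; apply: big_ind => //; first exact: subspace0.
by move=> u v; apply: subspaceD.
Qed.

Lemma subspace_sum_seq P (I : eqType) (r : seq I) (f : I -> V) :
  subspace P -> (forall i, i \in r -> P (f i)) -> P (\sum_(i <- r) f i).
Proof.
move=> sP Pf; rewrite big_seq; exact: subspace_sum.
Qed.

(** Taking the intersection of all subspaces around [A] makes the proof of an inclusion a mere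
    application. *)
Definition spanP A (x : V) := forall P, subspace P -> (forall a, A a -> P a) -> P x.

Lemma subspace_spanP A : subspace (spanP A).
Proof.
split=> [P [] //|a u v Hu Hv P sP AP].
by apply: subspaceD => //; [apply: subspaceZ => //; apply: Hu | apply: Hv].
Qed.

Lemma spanP_incl A a : A a -> spanP A a.
Proof. by move=> Aa P _; apply. Qed.

End Subspaces.
Arguments subspaceZ {F V P a u}.
Arguments subspaceD {F V P u v}.
Arguments subspaceN {F V P u}.
Arguments subspaceB {F V P u v}.

Section LinearMaps.
Variables (F : fieldType) (V W : lmodType F) (f : V -> W).
Hypothesis fL : linear f.

Lemma linP0 : f 0 = 0.
Proof. by have := fL 1 0 0; rewrite !scale1r addr0 => /eqP; rewrite -subr_eq0 opprD addrA subrr sub0r oppr_eq0 => /eqP. Qed.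

Lemma linPD u v : f (u + v) = f u + f v.
Proof. by have := fL 1 u v; rewrite !scale1r. Qed.

Lemma linPZ a u : f (a *: u) = a *: f u.
Proof. by have := fL a u 0; rewrite !addr0 linP0 addr0. Qed.

Lemma linPN u : f (- u) = - f u.
Proof. by rewrite -scaleN1r linPZ scaleN1r. Qed.

Lemma linPB u v : f (u - v) = f u - f v.
Proof. by rewrite linPD linPN. Qed.

Lemma linP_sum (I : Type) (r : seq I) (Q : pred I) (g : I -> V) :
  f (\sum_(i <- r | Q i) g i) = \sum_(i <- r | Q i) f (g i).
Proof. by apply: big_morph => [u v|]; [apply: linPD|apply: linP0]. Qed.

Lemma subspace_preim (P : W -> Prop) : subspace P -> subspace (fun u => P (f u)).
Proof.
move=> sP; split=> [|a u v Pu Pv]; first by rewrite linP0; apply: subspace0.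
by rewrite fL; apply: sP.2.
Qed.
End LinearMaps.

(** * Actions of the Ramond algebra without grading *)

Section Action.
Variable F : fieldType.

(* [br p q m n] and [cz p q m n] are the coefficients of the basis vector of degree [m + n]
   and of [c] in the super-bracket, [true] marking the odd generators [G]. *)
Definition br (p q : bool) (m n : int) : F :=
  match p, q with
  | false, false => (m - n)%:~R
  | false, true => m%:~R / 2%:R - n%:~R
  | true, false => m%:~R - n%:~R / 2%:R
  | true, true => 2%:R
  end.

Definition cz (p q : bool) (m n : int) : F :=
  match p, q with
  | false, false => zLL F m n
  | true, true => zGG F m n
  | _, _ => 0
  end.

Lemma cz0 p q m n : m + n != 0 -> cz p q m n = 0.
Proof.
by case: p; case: q => //= mn; rewrite /zLL /zGG /delta0 (negbTE mn) mul0r.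
Qed.

(** The grading is forgotten and the brackets become one reordering rule. The monomial calculus then
    applies both to [S] and to the product [S * N], where submodules generated by graphs live. *)
Record action (M : lmodType F) := Action {
  aX : bool -> int -> M -> M;
  aC : M -> M;
  aX_lin : forall p m, linear (aX p m);
  aC_lin : linear aC;
  aXX : forall p q m n v, aX p m (aX q n v) =
    (-1) ^+ (p && q) *: aX q n (aX p m v) + br p q m n *: aX (p (+) q) (m + n) v
    + cz p q m n *: aC v;
  aCX : forall p m v, aC (aX p m v) = aX p m (aC v)
}.

Lemma aX_subspace M (A : action M) p m P :
  subspace P -> subspace (fun u => P (aX A p m u)).
Proof. exact: (subspace_preim (@aX_lin _ A p m)). Qed.

Lemma aC_subspace M (A : action M) P :
  subspace P -> subspace (fun u => P (aC A u)).
Proof. exact: (subspace_preim (@aC_lin _ A)). Qed.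

Definition stable M (A : action M) (P : M -> Prop) :=
  [/\ subspace P, (forall p m v, P v -> P (aX A p m v)) & (forall v, P v -> P (aC A v))].

End Action.

Section RModAction.
Variables (F : numFieldType) (S : RMod F).

Definition rX (p : bool) (m : int) : S -> S := if p then rG S m else rL S m.

Lemma rX_lin p m : linear (rX p m).
Proof. by case: p; [apply: r_linG|apply: r_linL]. Qed.

Lemma rXX p q m n v : rX p m (rX q n v) =
    (-1) ^+ (p && q) *: rX q n (rX p m v) + br F p q m n *: rX (p (+) q) (m + n) v
    + cz F p q m n *: rc S v.
Proof.
case: p; case: q => /=.
- by rewrite expr1 scaleN1r -addrA -r_GG addrC addrK.
- rewrite expr0 scale1r scale0r addr0.
  have /eqP := r_LG n m v; rewrite subr_eq => /eqP ->.
  rewrite addrAC [m + n]addrC -scalerDl /cLG.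
  rewrite [X in X *: _](_ : _ = 0) ?scale0r ?add0r //; ring.
- by rewrite expr0 scale1r scale0r addr0 -/(cLG F m n) -r_LG addrC subrK.
- by rewrite expr0 scale1r -addrA -/(cLL F m n) -r_LL addrC subrK.
Qed.

Lemma rCX p m v : rc S (rX p m v) = rX p m (rc S v).
Proof. by case: p; [apply: r_cG|apply: r_cL]. Qed.

Definition ract : action S := Action rX_lin (@r_linc _ S) rXX rCX.
End RModAction.

Section ProdAction.
Variables (F : fieldType) (M N : lmodType F) (A : action M) (B : action N).

Definition pX p m (x : M * N) : M * N := (aX A p m x.1, aX B p m x.2).
Definition pC (x : M * N) : M * N := (aC A x.1, aC B x.2).

Lemma pX_lin p m : linear (pX p m).
Proof. by move=> a [u1 u2] [v1 v2]; rewrite /pX /= !aX_lin. Qed.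

Lemma pC_lin : linear pC.
Proof. by move=> a [u1 u2] [v1 v2]; rewrite /pC /= !aC_lin. Qed.

Lemma pXX p q m n v : pX p m (pX q n v) =
    (-1) ^+ (p && q) *: pX q n (pX p m v) + br F p q m n *: pX (p (+) q) (m + n) v
    + cz F p q m n *: pC v.
Proof. by congr (_, _); rewrite [LHS]aXX. Qed.

Lemma pCX p m v : pC (pX p m v) = pX p m (pC v).
Proof. by rewrite /pX /pC /= !aCX. Qed.

Definition prod_action : action (M * N)%type := Action pX_lin pC_lin pXX pCX.
End ProdAction.

(** * Ordered monomials *)

Section Words.
Variables (F : numFieldType) (M : lmodType F) (A : action M).

(* The letter [2k + e] stands for the creation operator of degree [-(k + 1)]: [L] if [e = 0], [G] if [e = 1]. *)
Definition ltr (a : nat) : M -> M := aX A (odd a) (- (a./2.+1)%:Z).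
Definition act (w : seq nat) (v : M) : M := foldr ltr v w.

(** The adjacency condition of ordered (PBW) monomials: an even letter may repeat, an odd one may
    not, its square being again a letter. *)
Definition nle (a b : nat) := (a < b)%N || ((a == b) && ~~ odd a).

Lemma ltr_lin a : linear (ltr a). Proof. exact: aX_lin. Qed.

Lemma act_lin w : linear (act w).
Proof. by elim: w => [|a w IH] // k u v; rewrite -[LHS]/(ltr a (act w _)) IH ltr_lin. Qed.

Lemma act_cat u w v : act (u ++ w) v = act u (act w v).
Proof. by rewrite /act foldr_cat. Qed.

Lemma nle_trans : transitive nle.
Proof. by move=> b a c; rewrite /nle; case: (odd a) (odd b) => [] [] /=; lia. Qed.

Lemma nle_leq : subrel nle leq.
Proof. by move=> a b; rewrite /nle; lia. Qed.

Lemma neg_index p (m : int) : m < 0 -> exists a, odd a = p /\ m = - (a./2.+1)%:Z.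
Proof.
move=> m0; exists (p + (`|m|.-1).*2)%N; split; first by rewrite oddD odd_double addbF; case: p.
by rewrite halfD odd_double andbF add0n doubleK; case: p => /=; lia.
Qed.

Lemma neg_letter p (m : int) : m < 0 -> exists a, forall x, aX A p m x = ltr a x.
Proof. by case/(neg_index p) => a [<- ->]; exists a. Qed.

(** The bracket of two letters has negative degree: it has no central term and is a multiple of a
    single letter. *)
Lemma ltr_swap a b : exists s r c, forall x,
  ltr a (ltr b x) = s *: ltr b (ltr a x) + r *: ltr c x.
Proof.
have [|c Hc] := @neg_letter (odd a (+) odd b) (- (a./2.+1)%:Z + - (b./2.+1)%:Z); first by lia.
exists ((-1) ^+ (odd a && odd b)), (br F (odd a) (odd b) (- (a./2.+1)%:Z) (- (b./2.+1)%:Z)), c.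
by move=> x; rewrite {1}/ltr aXX cz0 ?scale0r ?addr0 ?Hc //; lia.
Qed.

Lemma ltr_sqr a : odd a -> exists r c, forall x, ltr a (ltr a x) = r *: ltr c x.
Proof.
move=> oa; have [|c Hc] := @neg_letter false (- (a./2.+1)%:Z + - (a./2.+1)%:Z); first by lia.
exists 1, c => x; rewrite scale1r -Hc /ltr oa; set m := (- _).
have := aXX A true true m m x; rewrite cz0; last by rewrite /m; lia.
rewrite /= expr1 scaleN1r scale0r addr0 => /eqP; rewrite addrC -subr_eq opprK.
by rewrite -mulr2n -scaler_nat => /eqP /(congr1 (fun z => 2%:R^-1 *: z)); rewrite !scalerA mulVf ?pnatr_eq0 // !scale1r.
Qed.

Section Straighten.
Variable V0 : M -> Prop.
Hypothesis V0X : forall p m v, 0 <= m -> V0 v -> V0 (aX A p m v).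
Hypothesis V0C : forall v, V0 v -> V0 (aC A v).

Definition wspan (Q : seq nat -> Prop) :=
  spanP (fun x => exists w v, [/\ Q w, V0 v & x = act w v]).
Definition sspan := wspan (sorted nle).

Lemma subspace_wspan Q : subspace (wspan Q). Proof. exact: subspace_spanP. Qed.

Lemma wspan_incl (Q : seq nat -> Prop) w v : Q w -> V0 v -> wspan Q (act w v).
Proof. by move=> Qw Vv; apply: spanP_incl; exists w, v. Qed.

Lemma wspan_min (Q : seq nat -> Prop) P : subspace P ->
  (forall w v, Q w -> V0 v -> P (act w v)) -> forall x, wspan Q x -> P x.
Proof. by move=> sP H x; apply=> // _ [w [v [Qw Vv ->]]]; apply: H. Qed.

Lemma wspan_ltr n a x : wspan (fun w => size w < n)%N x ->
  wspan (fun w => size w < n.+1)%N (ltr a x).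
Proof.
apply: (@wspan_min _ (fun y => wspan _ (ltr a y))).
  exact: (subspace_preim (@ltr_lin a) (@subspace_wspan _)).
by move=> w v sw Vv; rewrite -[ltr a _]/(act (a :: w) v); apply: wspan_incl.
Qed.

(** Each transposition of neighbours produces a bracket, which merges two letters into one. Carrying
    [a] through [u] therefore costs a scalar and strictly shorter words. *)
Lemma bubble a u z v : V0 v -> exists s,
  wspan (fun w => size w <= size (u ++ z))%N (act (a :: u ++ z) v - s *: act (u ++ a :: z) v).
Proof.
move=> Vv; elim: u => [|b u [s IH]].
  by exists 1; rewrite scale1r subrr; apply: (subspace0 (@subspace_wspan _)).
have [s' [r [c sw]]] := ltr_swap a b.
exists (s' * s); rewrite /= sw.
rewrite addrAC; apply: (subspaceD (@subspace_wspan _)).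
  rewrite -scalerA -scalerBr -(linPZ (@ltr_lin b)) -(linPB (@ltr_lin b)).
  apply: (subspaceZ (@subspace_wspan _)).
  exact: (@wspan_ltr (size (u ++ z)).+1).
apply: (subspaceZ (@subspace_wspan _)).
by rewrite -[ltr c _]/(act (c :: u ++ z) v); apply: wspan_incl => /=.
Qed.

Lemma sorted_insert a (w : seq nat) : sorted leq w ->
  exists u z, w = u ++ z /\ sorted leq (u ++ a :: z).
Proof.
elim: w => [|b w IH] sw; first by exists [::], [::].
have [ab|ba] := leqP a b; first by exists [::], (b :: w); split => //=; rewrite ab.
have [u [z [ew suz]]] := IH (path_sorted sw).
exists (b :: u), z; rewrite ew; split => //=.
case: u ew suz => [|d u] ew //= suz; first by rewrite (ltnW ba).
by move: sw; rewrite ew /= => /andP[-> _].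
Qed.

(** Insertion sort modulo shorter words; repeated odd letters are still allowed at this stage. *)
Lemma sort_mod w v : V0 v -> exists s w1, [/\ sorted leq w1, size w1 = size w &
  wspan (fun u => size u < size w)%N (act w v - s *: act w1 v)].
Proof.
move=> Vv; elim: w => [|a w [s [w1 [sw1 zw1 H]]]].
  by exists 1, [::]; split=> //; rewrite scale1r subrr; apply: (subspace0 (@subspace_wspan _)).
have [u [z [ew suz]]] := sorted_insert a sw1.
have [s' Hb] := @bubble a u z v Vv.
exists (s * s'), (u ++ a :: z); split=> //.
  by rewrite /= -zw1 ew !size_cat /= addnS.
have -> : act (a :: w) v - (s * s') *: act (u ++ a :: z) v =
  ltr a (act w v - s *: act w1 v) + s *: (act (a :: u ++ z) v - s' *: act (u ++ a :: z) v).
  by rewrite (linPB (@ltr_lin a)) (linPZ (@ltr_lin a)) ew scalerBr scalerA addrA subrK.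
apply: (subspaceD (@subspace_wspan _)); first exact: wspan_ltr.
apply: (subspaceZ (@subspace_wspan _)).
by move: Hb; rewrite -ew zw1.
Qed.

Lemma sorted_dup (w : seq nat) : sorted leq w ->
  sorted nle w \/ exists u a z, odd a /\ w = u ++ a :: a :: z.
Proof.
elim: w => [|b w IH] sw; first by left.
case: (IH (path_sorted sw)) => [sn|[u [a [z [oa ->]]]]]; last by right; exists (b :: u), a, z.
case: w sw sn {IH} => [|d w] /=; first by left.
move=> /andP[bd _] sn; have [|nbd] := boolP (nle b d); first by left; apply/andP.
right; exists [::], b, w; have -> : d = b by move: nbd bd; rewrite /nle; lia.
by split=> //; move: nbd bd; rewrite /nle; lia.
Qed.

(** The spanning half of the PBW theorem, by induction on the length: after sorting, only a repeated
    odd letter can violate [nle], and [ltr_sqr] shortens such a word. *)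
Lemma straighten w v : V0 v -> sspan (act w v).
Proof.
move=> Vv; move: {2}(size w).+1 (ltnSn (size w)) => n.
elim: n w v Vv => [//|n IH] w v Vv; rewrite ltnS => wn.
have IHw x : wspan (fun u => size u < size w)%N x -> sspan x.
  apply: wspan_min; first exact: subspace_wspan.
  by move=> u v' uw Vv'; apply: IH => //; apply: leq_trans wn.
have [s [w1 [sw1 zw1 /IHw H]]] := sort_mod w Vv.
rewrite -[act w v](subrK (s *: act w1 v)).
apply: (subspaceD (@subspace_wspan _)) => //.
apply: (subspaceZ (@subspace_wspan _)).
case: (sorted_dup sw1) => [sn|[u [a [z [oa ew]]]]]; first exact: wspan_incl.
have [r [c Hr]] := ltr_sqr oa.
rewrite ew act_cat /= Hr (linPZ (@act_lin u)); apply: (subspaceZ (@subspace_wspan _)).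
rewrite -[ltr c _]/(act (c :: z) v) -act_cat; apply: IHw.
by apply: wspan_incl => //; rewrite -zw1 ew !size_cat /= !addnS.
Qed.

Lemma aC_act w v : aC A (act w v) = act w (aC A v).
Proof. by elim: w => //= a w IH; rewrite /ltr aCX IH. Qed.

(** A generator of negative degree is one more letter. Any other is carried to the right until [V0]
    absorbs it; the brackets met on the way may have any degree, so the induction runs over all [m]
    at once. *)
Lemma sspan_aX_act w v p m : V0 v -> sspan (aX A p m (act w v)).
Proof.
move=> Vv; elim: w p m => [|a w IH] p m.
  have [m0|m0] := ltP m 0; last exact: (@straighten [::] _ (V0X p m0 Vv)).
  by have [a ->] := neg_letter p m0; exact: (@straighten [:: a] v Vv).
have [m0|m0] := ltP m 0.
  by have [b ->] := neg_letter p m0; exact: (@straighten [:: b, a & w] v Vv).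
have sS : subspace sspan by exact: subspace_wspan.
rewrite [act _ _]/= {1}/ltr aXX; apply: (subspaceD sS); first apply: (subspaceD sS).
- apply: (subspaceZ sS).
  suff H x : sspan x -> sspan (ltr a x) by apply: H.
  apply: (@wspan_min _ (fun y => sspan (ltr a y))) => [|u v' _ Vv'].
    exact: (subspace_preim (@ltr_lin a) sS).
  exact: (@straighten (a :: u) v' Vv').
- exact: (subspaceZ sS).
- by apply: (subspaceZ sS); rewrite aC_act; apply: straighten; apply: V0C.
Qed.

(** Thus [sspan] is the stable subspace generated by [V0], and all its elements are sums of ordered
    monomials applied to [V0]. *)
Lemma sspan_stable : stable A sspan.
Proof.
have sS : subspace sspan by exact: subspace_wspan.
split=> // [p m|].
- apply: (@wspan_min _ (fun y => sspan (aX A p m y))) => [|w v _ Vv]; first exact: aX_subspace.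
  exact: sspan_aX_act.
- apply: (@wspan_min _ (fun y => sspan (aC A y))) => [|w v _ Vv]; first exact: aC_subspace.
  by rewrite aC_act; apply: straighten; apply: V0C.
Qed.

Hypothesis V0s : subspace V0.

Definition sorted_sum (x : M) := exists (s : seq (seq nat)) (f : seq nat -> M),
  [/\ uniq s, all (sorted nle) s, (forall w, V0 (f w)) & x = \sum_(w <- s) act w (f w)].

Lemma sspan_sorted_sum x : sspan x -> sorted_sum x.
Proof.
have extend (s s' : seq (seq nat)) (f : seq nat -> M) : uniq s -> uniq s' -> {subset s <= s'} ->
    \sum_(w <- s) act w (f w) = \sum_(w <- s') act w (if w \in s then f w else 0).
  move=> us us' ss'; rewrite [RHS](bigID (mem s)) /= [X in _ + X]big1 ?addr0; last first.
    by move=> w /negbTE ->; rewrite (linP0 (@act_lin w)).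
  rewrite [RHS](eq_bigr (fun w => act w (f w))); last by move=> w ->.
  rewrite -[RHS]big_filter; apply: perm_big; apply: uniq_perm => //; first exact: filter_uniq.
  by move=> w; rewrite mem_filter; case: (boolP (w \in s)) => //= /ss' ->.
apply: (@wspan_min _ sorted_sum) => [|w v sw Vv]; last first.
  by exists [:: w], (fun _ => v); split; rewrite /= ?sw ?big_seq1.
split; first by exists [::], (fun _ => 0); split=> // [_|]; [apply: subspace0|rewrite big_nil].
move=> a _ _ [s1 [f1 [u1 ss1 Vf1 ->]]] [s2 [f2 [u2 ss2 Vf2 ->]]].
exists (undup (s1 ++ s2)), (fun w => a *: (if w \in s1 then f1 w else 0) + if w \in s2 then f2 w else 0).
split; first exact: undup_uniq.
- apply/allP => w; rewrite mem_undup mem_cat => /orP[]; [exact: (allP ss1)|exact: (allP ss2)].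
- by move=> w; apply: V0s.2; case: ifP => // _; apply: subspace0.
rewrite (@extend s1 (undup (s1 ++ s2))) ?undup_uniq //; last by move=> w; rewrite mem_undup mem_cat => ->.
rewrite (@extend s2 (undup (s1 ++ s2))) ?undup_uniq //; last by move=> w; rewrite mem_undup mem_cat orbC => ->.
by rewrite scaler_sumr -big_split; apply: eq_bigr => w _ /=; rewrite act_lin.
Qed.

End Straighten.
End Words.

(** * Linear independence of ordered monomials *)

Section Independence.
Variables (F : numFieldType) (M : lmodType F) (A : action M) (t : nat).

(* Degrees and weights of the generators, compared lexicographically. They are chosen so that, up to lower
   terms, the operators [L_(t+k)], [G_(t+k)] are derivations along [L_(-k)], [G_(-k)] and kill every other letter,
   with [L_t] playing the role of a central element. *)
Definition gw (p : bool) (m : int) : int :=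
  if t == 0%N then (if p then 1 else 2)
  else if ~~ p then 0 else if m == 0 then 1 else if m == t%:Z then -1 else 0.
(** The weight of [L_t]. At level [0] the weight is the degree in [G_0], and [L_0] is the square of
    [G_0] up to a constant; at a positive level [L_t] preserves weights. *)
Definition tau : int := if t == 0%N then 2 else 0.
Definition wt (p : bool) (m : int) : int :=
  if m < 0 then 1 else if m <= t%:Z then gw p m else tau - 1.
Definition dl (m : int) : int := if m < 0 then - m else if m <= t%:Z then 0 else t%:Z - m.

Definition lexle (r d r' d' : int) := (r < r') || ((r == r') && (d <= d')).

(** The bracket with a letter, which has weight [1], does not exceed the sum of the degrees and
    weights of its two arguments; [lexle_central] says the same of the central term. *)
Lemma lexle_bracket p q (m : int) (k : nat) : 0 <= m ->
  lexle (dl (m - k.+1%:Z)) (wt (p (+) q) (m - k.+1%:Z)) (k.+1%:Z + dl m) (1 + wt p m).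
Proof.
rewrite /lexle /dl /wt /gw /tau => m0.
case: p q => [] [] /=; repeat case: ifP => ? //=; lia.
Qed.

Lemma lexle_central p (k : nat) :
  lexle 0 0 (k.+1%:Z + dl k.+1%:Z) (1 + wt p k.+1%:Z).
Proof.
rewrite /lexle /dl /wt /gw /tau.
case: p => /=; repeat case: ifP => ? //=; lia.
Qed.

(** The weights of the annihilator paired with [a] and of [b] add up to [tau]. The bound [tau - 1]
    says that this annihilator kills every letter other than [a] in the associated graded. *)
Lemma lexle_strict (a b : nat) : a != b ->
  lexle (dl (t%:Z + a./2.+1%:Z - b./2.+1%:Z)) (wt (odd a (+) odd b) (t%:Z + a./2.+1%:Z - b./2.+1%:Z))
    (b./2.+1%:Z - a./2.+1%:Z) (tau - 1).
Proof.
rewrite /lexle /dl /wt /gw /tau => ab.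
have : (a./2 != b./2) || (odd a != odd b).
  by move: ab; apply: contraR; rewrite -negb_and negbK => /andP[/eqP e1 /eqP e2]; rewrite -[a]odd_double_half -[b]odd_double_half e1 e2.
case: (odd a) (odd b) => [] [] /=; repeat case: ifP => ? //=; lia.
Qed.

(** One less than the sum [tau + 1] of the weights: in the associated graded, [L_t] is central. *)
Lemma lexle_top q (k : nat) :
  lexle (dl (t%:Z - k.+1%:Z)) (wt q (t%:Z - k.+1%:Z)) k.+1%:Z tau.
Proof.
rewrite /lexle /dl /wt /gw /tau.
case: q => /=; repeat case: ifP => ? //=; lia.
Qed.

(** An increasing filtration of a space killed by all generators of degree above [t]. It will be
    [Vfilt] at a positive level and [Wfilt] at level [0]. *)
Variable V : int -> M -> Prop.
Hypothesis Vs : forall e, subspace (V e).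
Hypothesis Vmono : forall e e' v, e <= e' -> V e v -> V e' v.
Hypothesis Vneg : forall e v, e < 0 -> V e v -> v = 0.
Hypothesis VX : forall p m e v, 0 <= m -> m <= t%:Z -> V e v -> V (e + gw p m) (aX A p m v).
Hypothesis VX0 : forall p m e v, t%:Z < m -> V e v -> aX A p m v = 0.
Hypothesis VC : forall e v, V e v -> V e (aC A v).
(** Injectivity of [L_t] on the associated graded, where it is homogeneous of weight [tau]. *)
Hypothesis Vinj : forall e v, V e v -> V (e + tau - 1) (aX A false t v) -> V (e - 1) v.

Definition wdeg (w : seq nat) : nat := sumn [seq a./2.+1 | a <- w].

Definition Fl (r d : int) := spanP (fun x => exists w e v, [/\ V e v, x = act A w v &
  lexle (wdeg w)%:Z ((size w)%:Z + e) r d]).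

Lemma subspace_Fl r d : subspace (Fl r d). Proof. exact: subspace_spanP. Qed.

Lemma Fl_incl r d w e v : V e v -> lexle (wdeg w)%:Z ((size w)%:Z + e) r d -> Fl r d (act A w v).
Proof. by move=> Vv H; apply: spanP_incl; exists w, e, v. Qed.

Lemma Fl_min r d P : subspace P -> (forall w e v, V e v ->
  lexle (wdeg w)%:Z ((size w)%:Z + e) r d -> P (act A w v)) -> forall x, Fl r d x -> P x.
Proof. by move=> sP H x; apply=> // _ [w [e [v [Vv -> h]]]]; apply: H Vv h. Qed.

Lemma Fl_mono r d r' d' x : lexle r d r' d' -> Fl r d x -> Fl r' d' x.
Proof.
move=> le; apply: Fl_min; first exact: subspace_Fl.
by move=> w e v Vv H; apply: (Fl_incl Vv); move: H le; rewrite /lexle; lia.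
Qed.

Lemma Fl_ltr a r d x : Fl r d x -> Fl (r + a./2.+1%:Z) (d + 1) (ltr A a x).
Proof.
apply: (@Fl_min _ _ (fun y => Fl _ _ (ltr A a y))).
  exact: (subspace_preim (@ltr_lin _ _ A a) (@subspace_Fl _ _)).
move=> w e v Vv H; apply: (@Fl_incl _ _ (a :: w) e v Vv).
by move: H; rewrite /lexle /wdeg /=; lia.
Qed.

Lemma Fl0 d x : Fl 0 d x -> V d x.
Proof.
apply: Fl_min => // -[|a w] e v Vv; rewrite /lexle /wdeg /=; last by lia.
by move=> H; apply: Vmono Vv; lia.
Qed.

(** The operator is moved past the first letter; [lexle_bracket] and [lexle_central] bound what the
    commutation leaves behind. *)
Lemma Fl_aX_act w e v p m : V e v ->
  Fl ((wdeg w)%:Z + dl m) ((size w)%:Z + e + wt p m) (aX A p m (act A w v)).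
Proof.
move=> Vv; elim: w p m => [|b w IH] p m; (have [m0|m0] := ltP m 0;
  first by (have [a [<- ->]] := neg_index p m0;
    match goal with |- context [act A ?w v] => apply: (@Fl_incl _ _ (a :: w) e v Vv) end; rewrite /lexle /wdeg /dl /wt /= ?ltrNl ?oppr0; lia)).
- have [mt|mt] := lerP m t%:Z; last first.
    by rewrite (VX0 p mt Vv); exact: (subspace0 (@subspace_Fl _ _)).
  apply: (@Fl_incl _ _ [::] _ _ (VX p m0 mt Vv)).
  have mF : (m < 0) = false by rewrite ltNge m0.
  by rewrite /lexle /dl /wt mF mt /wdeg /=; lia.
- rewrite -[act A (b :: w) v]/(ltr A b (act A w v)) {1}/ltr aXX.
  have sF := subspace_Fl ((wdeg (b :: w))%:Z + dl m) ((size (b :: w))%:Z + e + wt p m).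
  apply: (subspaceD sF); first apply: (subspaceD sF).
  + apply: (subspaceZ sF); apply: (Fl_mono _ (Fl_ltr (a:=b) (IH p m))).
    by rewrite /lexle /wdeg /=; lia.
  + apply: (subspaceZ sF); apply: (Fl_mono _ (IH _ _)).
    by have := lexle_bracket p (odd b) b./2 m0; rewrite /lexle /wdeg /=; lia.
  + have [mb|mb] := eqVneq (m + - (b./2.+1)%:Z) 0; last first.
      by rewrite cz0 // scale0r; apply: (subspace0 sF).
    apply: (subspaceZ sF); rewrite aC_act; apply: (Fl_incl (VC Vv)).
    have em : m = b./2.+1%:Z by lia.
    by have := lexle_central p b./2; rewrite em /lexle /wdeg /=; lia.
Qed.

Lemma Fl_aX p m r d x : Fl r d x -> Fl (r + dl m) (d + wt p m) (aX A p m x).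
Proof.
apply: (@Fl_min _ _ (fun y => Fl _ _ (aX A p m y))).
  by apply: aX_subspace; exact: subspace_Fl.
move=> w e v Vv H; apply: (Fl_mono _ (Fl_aX_act Vv)).
by move: H; rewrite /lexle; lia.
Qed.

(** By [lexle_top] every bracket of [L_t] with a letter loses one weight, and a central term loses
    degree. *)
Lemma Fl_top_comm w e v : V e v -> Fl (wdeg w)%:Z ((size w)%:Z + e + tau - 1)
  (aX A false t (act A w v) - act A w (aX A false t v)).
Proof.
move=> Vv; elim: w => [|b w IH]; first by rewrite subrr; exact: (subspace0 (@subspace_Fl _ _)).
have sF := subspace_Fl (wdeg (b :: w))%:Z ((size (b :: w))%:Z + e + tau - 1).
rewrite -[act A (b :: w) v]/(ltr A b (act A w v)) {1}/ltr aXX andFb expr0 scale1r addFb -[_ + _ + cz _ _ _ _ _ *: _]addrA [X in Fl _ _ X]addrAC.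
apply: (subspaceD sF); last apply: (subspaceD sF).
- rewrite -[aX A _ _ (aX A _ _ _)]/(ltr A b _) -(linPB (@ltr_lin _ _ A b)).
  apply: (Fl_mono _ (Fl_ltr (a:=b) IH)); rewrite /lexle /wdeg /=; lia.
- apply: (subspaceZ sF); apply: (Fl_mono _ (Fl_aX_act Vv)).
  by have := lexle_top (odd b) b./2; rewrite /lexle /wdeg /=; lia.
- have [mb|mb] := eqVneq (t%:Z + - (b./2.+1)%:Z) 0; last first.
    by rewrite cz0 // scale0r; apply: (subspace0 sF).
  apply: (subspaceZ sF); rewrite aC_act; apply: (Fl_incl (VC Vv)).
  by rewrite /lexle /wdeg /=; lia.
Qed.

(* The annihilator paired with the letter [a]; its bracket with [a] is [cst a] times [L_t], up to lower terms. *)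
Definition ann (a : nat) : M -> M := aX A (odd a) (t%:Z + a./2.+1%:Z).
Definition cst (a : nat) : F := br F (odd a) (odd a) (t%:Z + a./2.+1%:Z) (- (a./2.+1)%:Z).

Lemma dl_wt_ann p (k : nat) :
  dl (t%:Z + k.+1%:Z) = - k.+1%:Z /\ wt p (t%:Z + k.+1%:Z) = tau - 1.
Proof.
by rewrite /dl /wt; (have -> : (t%:Z + k.+1%:Z < 0) = false by lia);
  (have -> : (t%:Z + k.+1%:Z <= t%:Z) = false by lia); split; first lia.
Qed.

Lemma cst_neq0 a : cst a != 0.
Proof.
rewrite /cst /br; case: (odd a); first by rewrite pnatr_eq0.
by rewrite opprK intr_eq0; lia.
Qed.

(** The coefficient of the superderivation along [a]. On an ordered word it is [cst a] times the
    multiplicity if [a] is even, and [cst a] up to sign at the only occurrence if [a] is odd. *)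
Fixpoint kap (a : nat) (w : seq nat) : F :=
  if w is b :: w' then (if a == b then cst a else 0) + (-1) ^+ (odd a && odd b) * kap a w' else 0.

Lemma kap_notin a w : a \notin w -> kap a w = 0.
Proof.
elim: w => //= b w IH; rewrite inE negb_or => /andP[/negbTE -> /IH ->].
by rewrite mulr0 addr0.
Qed.

Lemma sorted_nle_odd a w : odd a -> sorted nle (a :: w) -> a \notin w.
Proof.
move=> oa /= /(order_path_min nle_trans) /allP H; apply/negP => /H.
by rewrite /nle ltnn eqxx oa.
Qed.

Lemma kap_neq0 a w : sorted nle w -> a \in w -> kap a w != 0.
Proof.
have [oa|ea] := boolP (odd a); last first.
  move=> _; have -> : kap a w = cst a *+ count_mem a w.
    elim: w => //= b w ->; rewrite (negbTE ea) expr0 mul1r eq_sym.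
    by case: eqP => _; rewrite ?mulrS ?add0r.
  by rewrite -has_pred1 has_count => H; rewrite mulrn_eq0 negb_or -lt0n H cst_neq0.
elim: w => // b w IH sw; rewrite inE /=; have [eab|nab] /= := eqVneq a b.
  move=> _; rewrite kap_notin ?mulr0 ?addr0 ?cst_neq0 //.
  by apply: sorted_nle_odd => //; rewrite eab.
move=> /(IH (path_sorted sw)) H; rewrite add0r mulf_neq0 //.
by rewrite signr_eq0.
Qed.

(** Up to one weight less, the annihilator acts as a derivation along [a] with [L_t] as coefficient:
    other letters contribute lower terms by [lexle_strict], and [L_t] moves to [v] by
    [Fl_top_comm]. *)
Lemma ann_act a w e v : sorted nle w -> V e v ->
  Fl ((wdeg w)%:Z - a./2.+1%:Z) ((size w)%:Z + e + tau - 2)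
    (ann a (act A w v) - kap a w *: act A (rem a w) (aX A false t v)).
Proof.
move=> sw Vv; elim: w sw => [|b w IH] sw.
  rewrite [kap _ _]/= scale0r subr0 /ann (VX0 _ _ Vv); last by lia.
  exact: (subspace0 (@subspace_Fl _ _)).
have {IH}IH := IH (path_sorted sw).
have sF := subspace_Fl ((wdeg (b :: w))%:Z - a./2.+1%:Z) ((size (b :: w))%:Z + e + tau - 2).
rewrite /ann -[act A (b :: w) v]/(ltr A b (act A w v)) {1}/ltr aXX -/(ann a _) -/(ltr A b _).
have FC : Fl ((wdeg (b :: w))%:Z - a./2.+1%:Z) ((size (b :: w))%:Z + e + tau - 2)
    (cz F (odd a) (odd b) (t%:Z + a./2.+1%:Z) (- (b./2.+1)%:Z) *: aC A (act A w v)).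
  have [mb|mb] := eqVneq (t%:Z + a./2.+1%:Z + - (b./2.+1)%:Z) 0; last first.
    by rewrite cz0 // scale0r; apply: (subspace0 sF).
  apply: (subspaceZ sF); rewrite aC_act; apply: (Fl_incl (VC Vv)).
  (* For [t > 0] the central term has smaller degree; for [t = 0] the degrees agree and [tau = 2]
     leaves enough weight. *)
  by rewrite /lexle /wdeg /tau /=; case: ifP => ?; lia.
have [eab|nab] := eqVneq a b; last first.
  have -> : rem a (b :: w) = b :: rem a w by rewrite /= eq_sym (negbTE nab).
  rewrite [kap _ _]/= (negbTE nab) add0r.
  rewrite -[_ + _ + cz _ _ _ _ _ *: _]addrA [X in Fl _ _ X]addrAC.
  apply: (subspaceD sF); last apply: (subspaceD sF) => //.
    rewrite -scalerA -scalerBr; apply: (subspaceZ sF).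
    rewrite -[act A (b :: _) _]/(ltr A b (act A (rem a w) (aX A false t v))).
    rewrite -(linPZ (@ltr_lin _ _ A b)) -(linPB (@ltr_lin _ _ A b)).
    by apply: (Fl_mono _ (Fl_ltr (a:=b) IH)); rewrite /lexle /wdeg /=; lia.
  apply: (subspaceZ sF); apply: (Fl_mono _ (Fl_aX_act Vv)).
  by have := lexle_strict nab; rewrite /lexle /wdeg /=; lia.
subst b; rewrite addbb addrK -/(cst a) [kap _ _]/= eqxx.
have -> : rem a (a :: w) = w by rewrite /= eqxx.
set u := aX A false t v; set y := act A w v; set s := (-1) ^+ _; set k := kap a w.
(* If [a] recurs in the ordered word then it is the head of [w], so removing it and putting it back
   restores [w]. *)
have Hk : k *: ltr A a (act A (rem a w) u) = k *: act A w u.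
  have [aw|/kap_notin k0] := boolP (a \in w); last by rewrite /k k0 !scale0r.
  congr (_ *: _); case: w sw aw @y @k IH FC sF => // d w sw aw _ _ _ _ _.
  suff -> : a = d by rewrite /= eqxx.
  apply/eqP; move: aw; rewrite inE => /orP[//|dw].
  have le_adw : sorted leq (a :: d :: w) by apply: sub_sorted sw; apply: nle_leq.
  have /= /andP[ad /(order_path_min leq_trans)/allP/(_ _ dw) da] := le_adw.
  by rewrite eqn_leq ad da.
have -> : s *: ltr A a (ann a y) + cst a *: aX A false t y +
    cz F (odd a) (odd a) (t%:Z + a./2.+1%:Z) (- (a./2.+1)%:Z) *: aC A y
    - (cst a + s * k) *: act A w u =
  s *: ltr A a (ann a y - k *: act A (rem a w) u) + cst a *: (aX A false t y - act A w u) +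
    cz F (odd a) (odd a) (t%:Z + a./2.+1%:Z) (- (a./2.+1)%:Z) *: aC A y.
  rewrite (linPB (@ltr_lin _ _ A a)) (linPZ (@ltr_lin _ _ A a)) Hk !scalerBr scalerDl scalerA.
  by rewrite opprD [LHS](AC (3*2) ((1*5)*(2*4)*3)).
apply: (subspaceD sF) => //; apply: (subspaceD sF).
  apply: (subspaceZ sF); apply: (Fl_mono _ (Fl_ltr (a:=a) IH)).
  by rewrite /lexle /wdeg /=; lia.
apply: (subspaceZ sF); apply: (Fl_mono _ (Fl_top_comm Vv)).
by rewrite /lexle /wdeg /=; lia.
Qed.

Lemma wdeg_rem a w : a \in w -> (wdeg w = wdeg (rem a w) + a./2.+1)%N.
Proof.
elim: w => // b w IH; rewrite inE /wdeg /= eq_sym; case: eqP => [-> _|_ /= /IH H]; first by rewrite addnC.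
by move: H; rewrite /wdeg => ->; rewrite /= addnA.
Qed.

Lemma sorted_rem_inj a w1 w2 : sorted nle w1 -> sorted nle w2 -> a \in w1 -> a \in w2 ->
  rem a w1 = rem a w2 -> w1 = w2.
Proof.
move=> s1 s2 a1 a2 e; apply: (@sorted_eq _ leq) => //.
- exact: leq_trans.
- by move=> x y; rewrite -eqn_leq => /eqP.
- by apply: sub_sorted s1; apply: nle_leq.
- by apply: sub_sorted s2; apply: nle_leq.
- by apply: perm_trans (perm_to_rem a1) _; rewrite e perm_sym perm_to_rem.
Qed.

(* Induction on the degree: annihilators lower the degree of a relation and multiply its coefficients by [L_t]. *)
Lemma independent_step (r : nat) (d : int) (s : seq (seq nat * M)) :
  uniq (map fst s) ->
  (forall p, p \in s -> [/\ sorted nle p.1, wdeg p.1 = r & V (d - (size p.1)%:Z) p.2]) ->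
  Fl r%:Z (d - 1) (\sum_(p <- s) act A p.1 p.2) ->
  forall p, p \in s -> V (d - (size p.1)%:Z - 1) p.2.
Proof.
elim/ltn_ind: r d s => r IH d s us Hs Hx.
suff H (w : seq nat) (v : M) : (w, v) \in s -> V (d - (size w)%:Z - 1) v by move=> [w v] /H.
move=> ps.
have [sw wr Vv] := Hs _ ps; rewrite /= in sw wr Vv *.
case: w ps sw wr Vv => [|a w] ps sw wr Vv.
  have r0 : r = 0%N by rewrite -wr.
  have es : s = [:: ([::], v)].
    have H p : p \in s -> p.1 = [::].
      by move=> /Hs[_]; rewrite r0; case: p.1.
    case: s ps us {Hs Hx} H => [|p1 [|p2 s]] //= ps us H.
      by move: ps; rewrite inE => /eqP ->.
    by move: us; rewrite (H p1) ?(H p2) ?inE ?eqxx ?orbT.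
  move: Hx; rewrite es r0 big_seq1 /= => /Fl0.
  by rewrite subr0.
(* The relation is hit with the annihilator of the first letter of the chosen word; words without
   this letter drop out. *)
pose s' := [seq (rem a q.1, kap a q.1 *: aX A false t q.2) | q <- s & a \in q.1].
have kr : (a./2.+1 <= r)%N by rewrite -wr /wdeg /= leq_addr.
have rk : (r - a./2.+1 < r)%N by lia.
have sF := subspace_Fl (r - a./2.+1)%N%:Z (d + tau - 1 - 1).
(* The new bound is [d + tau - 1] because each word loses one letter and each coefficient gains the
   weight of [L_t]. *)
have IHs : forall p, p \in s' -> V (d + tau - 1 - (size p.1)%:Z - 1) p.2.
  apply: (IH _ rk).
  - rewrite /s' -map_comp map_inj_in_uniq; first by apply: filter_uniq; apply: map_uniq us.
    move=> q1 q2; rewrite !mem_filter => /andP[a1 q1s] /andP[a2 q2s] /= e.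
    have [s1 _ _] := Hs _ q1s; have [s2 _ _] := Hs _ q2s.
    have e12 := sorted_rem_inj s1 s2 a1 a2 e.
    apply/eqP; apply/negP => /negP n12.
    move: us n12; move: q1s q2s e12; clear => q1s q2s e12 us.
    case/splitPr: q1s us q2s => s1 s2; rewrite map_cat /= cat_uniq => /and3P[_ h1 /andP[h2 _]].
    move: h1; rewrite /= negb_or => /andP[h1 _]; rewrite mem_cat inE => /or3P[h|/eqP ->|h]; last 2 first.
    + by rewrite eqxx.
    + by case/negP: h2; rewrite e12 map_f.
    + by case/negP: h1; rewrite e12 map_f.
  - move=> p' /mapP[[w2 v2]]; rewrite mem_filter /= => /andP[aq qs] -> /=.
    have [/= s1 wq Vq] := Hs _ qs; split.
    + exact: (subseq_sorted nle_trans (rem_subseq _ _)).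
    + by rewrite -wq (wdeg_rem aq) addnK.
    + apply: (subspaceZ (Vs _)).
      have := VX false (m := t%:Z) (le0z_nat _) (lexx _) Vq.
      have -> : gw false t = tau by rewrite /gw /tau.
      have [n hn] : exists n, size w2 = n.+1 by case: (w2) aq => [//|x y _]; exists (size y).
      by rewrite hn (size_rem aq) hn => h3; apply: Vmono h3; lia.
  - have H := Fl_aX (p:=odd a) (m:=t%:Z + a./2.+1%:Z) Hx.
    have {}H : Fl (r - a./2.+1)%N%:Z (d + tau - 1 - 1) (ann a (\sum_(p <- s) act A p.1 p.2)).
      apply: (Fl_mono _ H); have [-> ->] := dl_wt_ann (odd a) a./2.
      by rewrite /lexle; lia.
    rewrite -[X in Fl _ _ X](subrK (ann a (\sum_(p <- s) act A p.1 p.2))); apply: (subspaceD sF) => //.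
    rewrite -opprB; apply: (subspaceN sF).
    have -> : \sum_(p <- s') act A p.1 p.2 = \sum_(p <- s) kap a p.1 *: act A (rem a p.1) (aX A false t p.2).
      rewrite /s' big_map big_filter [RHS](bigID (fun p => a \in p.1)) /= [X in _ + X]big1 ?addr0.
        by apply: eq_bigr => q _; rewrite (linPZ (@act_lin _ _ A _)).
      by move=> q /kap_notin ->; rewrite scale0r.
    rewrite /ann (linP_sum (aX_lin A _ _)) -sumrB; apply: (subspace_sum_seq sF) => -[w2 v2] qs.
    have [/= sq wq Vq] := Hs _ qs; apply: (Fl_mono _ (ann_act (a:=a) sq Vq)).
    by rewrite /lexle wq; lia.
have aw : a \in a :: w by rewrite inE eqxx.
have : (rem a (a :: w), kap a (a :: w) *: aX A false t v) \in s'.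
  by apply/mapP; exists (a :: w, v) => //; rewrite mem_filter aw.
move=> /IHs /= /(subspaceZ (a := (kap a (a :: w))^-1) (Vs _)).
rewrite scalerA mulVf ?kap_neq0 // scale1r eqxx => H.
by apply: Vinj => //; apply: Vmono H; rewrite /=; lia.
Qed.

(** Words of top degree [m] are treated first. Their sum equals one of lower degree, so it lies in
    [Fl m d] for every [d]; iterating [independent_step] pushes their coefficients down the
    filtration until [Vneg] makes them vanish. *)
Lemma independent (s : seq (seq nat * M)) : uniq (map fst s) ->
  (forall p, p \in s -> sorted nle p.1 /\ exists e, V e p.2) ->
  \sum_(p <- s) act A p.1 p.2 = 0 -> forall p, p \in s -> p.2 = 0.
Proof.
move=> us Hs; have [m] : exists m, forall p, p \in s -> (wdeg p.1 < m)%N.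
  exists (\max_(p <- s) wdeg p.1).+1 => p ps.
  by rewrite ltnS; apply: (@leq_bigmax_seq _ s xpredT (fun p => wdeg p.1)).
elim: m s us Hs => [|m IH] s us Hs Hm Hx p ps; first by have := Hm _ ps.
pose s1 := [seq q <- s | wdeg q.1 == m]; pose s2 := [seq q <- s | wdeg q.1 != m].
have u1 : uniq (map fst s1) by apply: subseq_uniq us; apply: map_subseq; apply: filter_subseq.
have u2 : uniq (map fst s2) by apply: subseq_uniq us; apply: map_subseq; apply: filter_subseq.
have sx : \sum_(q <- s) act A q.1 q.2 = \sum_(q <- s1) act A q.1 q.2 + \sum_(q <- s2) act A q.1 q.2.
  by rewrite !big_filter (bigID (fun q => wdeg q.1 == m)).
have F2 d : Fl m%:Z d (\sum_(q <- s1) act A q.1 q.2).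
  move: Hx; rewrite sx => /eqP; rewrite addr_eq0 => /eqP ->.
  apply: (subspaceN (subspace_Fl _ _)); apply: (subspace_sum_seq (subspace_Fl _ _)) => -[w v].
  rewrite mem_filter /= => /andP[nq qs]; have [/= sq [e Vq]] := Hs _ qs.
  have wm : (wdeg w < m)%N by rewrite ltn_neqAle nq -ltnS; apply: Hm qs.
  by apply: (Fl_incl Vq); rewrite /lexle; lia.
have [d0 Hd0] : exists d, forall q, q \in s -> V (d - (size q.1)%:Z) q.2.
  have : forall q, q \in s -> exists e, V e q.2 by move=> q /Hs[].
  elim: (s) => [|q s' IHs] Hs'; first by exists 0.
  have [|d Hd] := IHs; first by move=> q' qs'; apply: Hs'; rewrite inE qs' orbT.
  have [|e Ve] := Hs' q; first by rewrite inE eqxx.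
  exists (Num.max d (e + (size q.1)%:Z)) => q'; rewrite inE => /orP[/eqP ->|/Hd].
    by apply: Vmono Ve; rewrite lerBrDr le_max lexx orbT.
  by apply: Vmono; rewrite lerD2r le_max lexx.
have z1 : forall q, q \in s1 -> q.2 = 0.
  have desc j : forall q, q \in s1 -> V (d0 - j%:Z - (size q.1)%:Z) q.2.
    elim: j => [|j IHj] q qs1.
      by rewrite subr0; apply: Hd0; move: qs1; rewrite mem_filter => /andP[].
    have := @independent_step m (d0 - j%:Z) s1 u1 _ (F2 _) q qs1.
    move=> H; apply: Vmono (H _); first by lia.
    move=> q' qs'; split; [|by move: qs'; rewrite mem_filter => /andP[/eqP]|exact: IHj].
    by move: qs'; rewrite mem_filter => /andP[_ /Hs[]].
  move=> q qs1; apply: (Vneg _ (desc (`|d0|.+1)%N q qs1)); lia.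
have [pm|pm] := boolP (wdeg p.1 == m); first by apply: z1; rewrite mem_filter pm.
apply: (IH s2) => //; last by rewrite mem_filter pm.
- by move=> q; rewrite mem_filter => /andP[_ /Hs].
- by move=> q; rewrite mem_filter => /andP[nq /Hm]; rewrite ltnS leq_eqVlt (negbTE nq).
- move: Hx; rewrite sx [X in X + _]big_seq big1 ?add0r // => q qs1.
  by rewrite z1 // (linP0 (@act_lin _ _ A _)).
Qed.

Definition exhausted (v : M) := exists e, V e v.

Lemma subspace_exhausted : subspace exhausted.
Proof.
split=> [|a u v [e Ve] [e' Ve']]; first by exists 0; apply: (subspace0 (Vs 0)).
exists (Num.max e e'); apply: (Vs _).2.
  by apply: Vmono Ve; rewrite le_max lexx.
by apply: Vmono Ve'; rewrite le_max lexx orbT.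
Qed.

Lemma independent_fun (s : seq (seq nat)) (f : seq nat -> M) : uniq s -> all (sorted nle) s ->
  (forall w, exhausted (f w)) -> \sum_(w <- s) act A w (f w) = 0 -> forall w, w \in s -> f w = 0.
Proof.
move=> us ss Hf Hx w ws; pose s' := [seq (w, f w) | w <- s].
apply: (@independent s' _ _ _ (w, f w)); last by apply/mapP; exists w.
- by rewrite -map_comp map_id.
- by move=> _ /mapP[u us' ->] /=; split; [exact: (allP ss)|exact: Hf].
- by rewrite big_map.
Qed.

(** The coefficient of the empty word is unique, so generating from [U] adds nothing inside the
    filtered space. This gives the simplicity of [base] and the contradiction at level [0]. *)
Lemma sspan_cap (U : M -> Prop) x : subspace U -> (forall v, U v -> exhausted v) ->
  exhausted x -> sspan A U x -> U x.
Proof.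
move=> sU UV Vx /(sspan_sorted_sum sU) [s [f [us ss Uf ex]]].
have [n_s|n_s] := boolP ([::] \in s).
  suff e : f [::] - x = 0 by rewrite -[x](subrK (f [::])) -opprB e oppr0 add0r.
  have := @independent_fun s (fun w => f w - (if w == [::] then x else 0)) us ss.
  move=> H; have := H _ _ [::] n_s; rewrite eqxx; apply.
    move=> w; apply: (subspaceB subspace_exhausted); first exact: UV.
    by case: ifP => // _; apply: (subspace0 subspace_exhausted).
  rewrite (eq_bigr (fun w => act A w (f w) - (if w == [::] then x else 0))); last first.
    by move=> w _; rewrite (linPB (@act_lin _ _ A w)); case: eqP => [->|] //=; rewrite (linP0 (@act_lin _ _ A w)).
  rewrite sumrB -ex -big_mkcond /= -big_filter.
  by rewrite (_ : [seq w <- s | w == [::]] = [:: [::]]) ?big_seq1 ?subrr // filter_pred1_uniq.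
suff -> : x = 0 by apply: subspace0.
have := @independent_fun ([::] :: s) (fun w => if w == [::] then - x else f w).
move=> H; have := H _ _ _ _ [::]; rewrite /= inE eqxx n_s us => /(_ isT ss) {}H.
apply/eqP; rewrite -oppr_eq0; apply/eqP; apply: H => //.
  by move=> w; case: ifP => _; [apply: (subspaceN subspace_exhausted)|apply: UV].
rewrite big_cons /= (_ : \sum_(w <- s) _ = x) ?addNr // [RHS]ex; apply: eq_big_seq => w ws.
by case: eqP => // w0; move: n_s; rewrite -w0 ws.
Qed.

End Independence.

(** * Finite-dimensional subspaces and smooth vectors *)

Section FiniteSpans.
Variables (F : numFieldType) (V : lmodType F).
Implicit Types (s : seq V) (P : V -> Prop).

Lemma subspace_in_span s : subspace (in_span s).
Proof.
split; first by exists (fun _ => 0); rewrite big1 // => i _; rewrite scale0r.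
move=> a _ _ [b ->] [c ->]; exists (fun i => a * b i + c i).
by rewrite scaler_sumr -big_split; apply: eq_bigr => i _; rewrite scalerDl scalerA.
Qed.

Lemma in_span_mem s u : u \in s -> in_span s u.
Proof.
move=> us; exists (fun i => (i == index u s)%:R).
have iu : (index u s < size s)%N by rewrite index_mem.
rewrite (bigD1 (Ordinal iu)) //= eqxx scale1r nth_index // big1 ?addr0 // => i ni.
by rewrite (_ : (i == index u s :> nat) = false) ?scale0r //; apply: contraNF ni => /eqP e; apply/eqP/val_inj.
Qed.

Lemma in_span_min s P x : subspace P -> (forall u, u \in s -> P u) -> in_span s x -> P x.
Proof.
move=> sP H [a ->]; apply: subspace_sum => // i _.
by apply: subspaceZ => //; apply: H; apply: mem_nth.
Qed.

Lemma in_span_sub s s' x : {subset s <= s'} -> in_span s x -> in_span s' x.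
Proof. by move=> ss; apply: in_span_min (subspace_in_span _) _ => u /ss; apply: in_span_mem. Qed.

Lemma in_span_cons e s u : in_span (e :: s) u -> exists a, in_span s (u - a *: e).
Proof.
move=> [a ->]; exists (a 0%N); rewrite big_ord_recl /= addrC addKr.
by exists (fun i => a i.+1).
Qed.

(** A list whose span contains [P] need not lie in [P]. Elimination of [e] corrects this: an element
    of [P] with nonzero coefficient at [e], if there is one, takes its place. *)
Lemma inner_span s P : subspace P -> (forall u, P u -> in_span s u) ->
  exists s', (forall u, u \in s' -> P u) /\ forall u, P u -> in_span s' u.
Proof.
elim: s P => [|e s IH] P sP Hs; first by exists [::].
pose Q u := P u /\ in_span s u.
have sQ : subspace Q.
  split=> [|a u v [Pu su] [Pv sv]]; first by split; [case: sP | case: (subspace_in_span s)].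
  by split; [apply: sP.2 | apply: (subspace_in_span s).2].
have [s' [s'Q Qs']] := IH Q sQ (fun u => @proj2 _ _).
have [[z [a [Pz a0 sz]]]|nz] := pselect (exists z a, [/\ P z, a != 0 & in_span s (z - a *: e)]); last first.
  exists s'; split=> [u /s'Q[] //|u Pu]; apply: Qs'; split=> //.
  have [b Hb] := in_span_cons (Hs _ Pu); have [b0|b0] := eqVneq b 0.
    by move: Hb; rewrite b0 scale0r subr0.
  by case: nz; exists u, b.
exists (z :: s'); split=> [u|u Pu]; first by rewrite inE => /orP[/eqP -> //|/s'Q[]].
have [b Hb] := in_span_cons (Hs _ Pu).
rewrite -[u](subrK ((b / a) *: z)); apply: (subspaceD (subspace_in_span _)); last first.
  by apply: (subspaceZ (subspace_in_span _)); apply: in_span_mem; rewrite inE eqxx.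
apply: (@in_span_sub s'); first by move=> y ys; rewrite inE ys orbT.
apply: Qs'; split; first by apply: (subspaceB sP) => //; apply: (subspaceZ sP).
have -> : u - (b / a) *: z = (u - b *: e) - (b / a) *: (z - a *: e).
  by rewrite scalerBr scalerA divfK // opprB addrA [_ - (b *: e) + _]addrNK.
by apply: (subspaceB (subspace_in_span _)) => //; apply: (subspaceZ (subspace_in_span _)).
Qed.

Lemma sum_coef_widen (f : {poly F}) n (g : nat -> V) : (size f <= n)%N ->
  \sum_(j < size f) f`_j *: g j = \sum_(j < n) f`_j *: g j.
Proof.
move=> fn; rewrite (big_ord_widen _ (fun j => f`_j *: g j) fn) big_mkcond /=.
apply: eq_bigr => i _; case: ltnP => // /leq_sizeP /(_ _ (leqnn _)) ->.
by rewrite scale0r.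
Qed.

(** There are [d * size s] linear equations for one more unknown, the coefficients of [f]. The size
    bound serves in [countable_dim_eigenvalue]. *)
Lemma poly_dependence s (d : nat) (g : nat -> nat -> V) :
  (forall j e, (e < d)%N -> in_span s (g j e)) ->
  exists f : {poly F}, [/\ f != 0, (size f <= (d * size s).+1)%N &
    forall e, (e < d)%N -> \sum_(j < size f) f`_j *: g j e = 0].
Proof.
move=> Hg; set n := size s; set D := (d * n)%N.
have [a Ha] : exists a : nat -> nat -> nat -> F, forall j e, (e < d)%N ->
    g j e = \sum_(i < n) a j e i *: nth 0 s i.
  have H je : exists b : nat -> F, (je.2 < d)%N -> g je.1 je.2 = \sum_(i < n) b i *: nth 0 s i.
    case: je => j e /=; have [ed|_] := ltnP e d; last by exists (fun _ => 0).
    by have [b Hb] := Hg j e ed; exists b.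
  by have [b Hb] := choice H; exists (fun j e => b (j, e)) => j e; apply: (Hb (j, e)).
pose A : 'M[F]_(D.+1, D) := \matrix_(j, k) mxvec (\matrix_(e < d, i < n) a j e i) 0 k.
have /rowV0Pn[v vA v0] : kermx A != 0.
  by rewrite -mxrank_eq0 mxrank_ker subn_eq0 -ltnNge ltnS rank_leq_col.
move/sub_kermxP: vA => vA.
pose f := \poly_(j < D.+1) v 0 (inord j).
have fs : (size f <= D.+1)%N by apply: size_poly.
exists f; split=> //.
  apply: contraNneq v0 => f0; apply/eqP/rowP => j; rewrite mxE.
  have := coef_poly D.+1 (fun j => v 0 (inord j)) j.
  by rewrite -/f f0 coef0 ltn_ord inord_val.
move=> e ed; rewrite (sum_coef_widen (fun j => g j e) fs).
have -> : \sum_(j < D.+1) f`_j *: g j e =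
    \sum_(i < n) (\sum_(j < D.+1) v 0 j * a j e i) *: nth 0 s i.
  under [RHS]eq_bigr do rewrite scaler_suml.
  rewrite exchange_big /=; apply: eq_bigr => j _.
  rewrite coef_poly ltn_ord inord_val Ha // scaler_sumr.
  by apply: eq_bigr => i _; rewrite scalerA.
rewrite big1 // => i _.
have /rowP/(_ (mxvec_index (Ordinal ed) i)) := vA.
rewrite !mxE => H; rewrite [X in X *: _](_ : _ = 0) ?scale0r // -[RHS]H.
by apply: eq_bigr => j _; rewrite !mxE mxvecE mxE.
Qed.

End FiniteSpans.

Section Modules.
Variables (F : numFieldType) (S : RMod F).
Local Notation X := (@rX F S).
Local Notation A := (ract S).

Lemma stable_rL_rG (P : S -> Prop) : stable A P <->
  [/\ subspace P, (forall m u, P u -> P (rL S m u) /\ P (rG S m u)) & (forall u, P u -> P (rc S u))].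
Proof.
split=> -[sP PX PC]; split=> //.
  by move=> m u Pu; split; [apply: (PX false)|apply: (PX true)].
by move=> [] m u /(PX m)[].
Qed.

Lemma rX_homog p m v : (rev S v -> if p then rod S (X p m v) else rev S (X p m v)) /\
  (rod S v -> if p then rev S (X p m v) else rod S (X p m v)).
Proof. by case: p; [apply: r_parG|apply: r_parL]. Qed.

Lemma homog_sum0 (u v : S) : rev S u -> rod S v -> u + v = 0 -> u = 0 /\ v = 0.
Proof.
have [s0 s1 _ H] := r_grading S; move=> u0 v1 /eqP; rewrite addr_eq0 => /eqP uv.
have u1 : u = 0 by apply: H => //; rewrite uv; apply: (subspaceN s1).
by split=> //; apply/eqP; rewrite -oppr_eq0 -uv u1.
Qed.

Lemma rX_sum0 p m u v : rev S u -> rod S v -> X p m (u + v) = 0 -> X p m u = 0 /\ X p m v = 0.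
Proof.
rewrite (linPD (@rX_lin F S p m)) => u0 v1.
case: p (rX_homog p m u).1 (rX_homog p m v).2 => /(_ u0) hu /(_ v1) hv; last exact: homog_sum0.
by rewrite addrC => /(homog_sum0 hv hu)[].
Qed.

Lemma homog_decomp (v : S) : exists v0 v1, [/\ rev S v0, rod S v1 & v = v0 + v1].
Proof. by case: (r_grading S). Qed.

(** A stable subspace need not be graded, but the sums of homogeneous elements of [P] form a graded
    submodule, which contains [v] because [v] is homogeneous. *)
Lemma simple_generates v P : r_simple S -> v != 0 -> rev S v \/ rod S v ->
  stable A P -> P v -> forall x, P x.
Proof.
move=> [_ simS] v0 hv [sP PX PC] Pv.
have [s0 s1 _ _] := r_grading S.
pose W x := exists x0 x1, [/\ rev S x0, rod S x1, P x0, P x1 & x = x0 + x1].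
have WX p m x : W x -> W (X p m x).
  move=> [x0 [x1 [e0 o1 P0 P1 ->]]]; rewrite (linPD (@rX_lin F S p m)).
  have h0 := (rX_homog p m x0).1 e0; have h1 := (rX_homog p m x1).2 o1.
  case: p h0 h1 => h0 h1; last by exists (X false m x0), (X false m x1); split=> //; apply: (PX false).
  by exists (X true m x1), (X true m x0); split=> //; [apply: (PX true)|apply: (PX true)|rewrite addrC].
have Wv : W v.
  by case: hv => h; [exists v, 0; rewrite addr0|exists 0, v; rewrite add0r]; split=> //; try exact: subspace0.
case: (simS W) => [|W0|W1 x].
- split.
  + split; first by exists 0, 0; split; rewrite ?addr0 //; apply: subspace0.
    move=> a _ _ [x0 [x1 [e0 o1 P0 P1 ->]]] [y0 [y1 [f0 p1 Q0 Q1 ->]]].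
    exists (a *: x0 + y0), (a *: x1 + y1); split; [exact: s0.2|exact: s1.2|exact: sP.2|exact: sP.2|].
    by rewrite scalerDr addrACA.
  + by move=> m w Ww; split; [apply: (WX false)|apply: (WX true)].
  + move=> _ [x0 [x1 [e0 o1 P0 P1 ->]]]; exists (rc S x0), (rc S x1).
    split; [exact: (r_parc _).1|exact: (r_parc _).2|exact: PC|exact: PC|exact: (linPD (@r_linc F S))].
  + move=> _ [x0 [x1 [e0 o1 P0 P1 ->]]]; exists x0, x1; split=> //.
    * by exists x0, 0; split; rewrite ?addr0 //; apply: subspace0.
    * by exists 0, x1; split; rewrite ?add0r //; apply: subspace0.
- by move: v0; rewrite (W0 _ Wv) eqxx.
- by have [x0 [x1 [_ _ P0 P1 ->]]] := W1 x; apply: subspaceD.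
Qed.

Definition killed (n : nat) (v : S) := forall p (m : int), n%:Z < m -> X p m v = 0.

Lemma killed_le n n' v : (n <= n')%N -> killed n v -> killed n' v.
Proof. by move=> nn' kv p m nm; apply: kv; lia. Qed.

Lemma killed_homog n u v : rev S u -> rod S v -> killed n (u + v) -> killed n u /\ killed n v.
Proof. by move=> u0 v1 k; split=> p m /(k p); case/(rX_sum0 u0 v1). Qed.

Lemma killed_subspace n : subspace (killed n).
Proof.
split=> [p m _|a u v ku kv p m nm]; first by rewrite (linP0 (@rX_lin F S p m)).
by rewrite rX_lin ku // kv // scaler0 addr0.
Qed.

Lemma killed_rc n v : killed n v -> killed n (rc S v).
Proof. by move=> kv p m nm; rewrite -rCX kv // (linP0 (@r_linc F S)). Qed.

Lemma killed_rX n p m v : killed n v -> killed (n + `|m|) (X p m v).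
Proof.
move=> kv q k nk; rewrite rXX cz0; last by lia.
have -> : X (q (+) p) (k + m) v = 0 by apply: kv; lia.
rewrite (kv q k); last by lia.
by rewrite (linP0 (@rX_lin F S p m)) !scaler0 scale0r !addr0.
Qed.

Lemma killed_nonneg n p (m : int) (v : S) : 0 <= m -> killed n v -> killed n (X p m v).
Proof.
move=> m0 kv q k nk; rewrite rXX cz0; last by lia.
rewrite kv // (linP0 (@rX_lin F S p m)) scaler0 add0r scale0r addr0.
by rewrite (_ : X _ _ v = 0) ?scaler0 //; apply: kv; lia.
Qed.

Definition smooth_vec (v : S) := exists n, killed n v.

Lemma smooth_vec_stable : stable A smooth_vec.
Proof.
split=> [|p m v [n kv]|v [n kv]]; last 2 first.
- by exists (n + `|m|)%N; apply: killed_rX.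
- by exists n; apply: killed_rc.
split=> [|a u v [n ku] [n' kv]]; first by exists 0%N; case: (killed_subspace 0).
exists (maxn n n'); apply: (killed_subspace _).2.
  by apply: killed_le ku; apply: leq_maxl.
by apply: killed_le kv; apply: leq_maxr.
Qed.

Lemma smoothE : smooth S <-> forall v, smooth_vec v.
Proof.
split=> H v; have [n Hn] := H v; exists n; first by move=> [] m /Hn[].
by move=> m nm; split; [apply: (Hn false)|apply: (Hn true)|move=> m0; lia].
Qed.

Lemma simple_smooth v : r_simple S -> v != 0 -> smooth_vec v -> smooth S.
Proof.
move=> simS v0 [n kv]; apply/smoothE => x.
have [u0 [u1 [e0 o1 ev]]] := homog_decomp v.
have [k0 k1] : killed n u0 /\ killed n u1 by apply: killed_homog => //; rewrite -ev.
have [z0|z0] := eqVneq u0 0; last first.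
  by apply: (simple_generates simS z0 (or_introl e0) smooth_vec_stable); exists n.
have z1 : u1 != 0 by move: v0; rewrite ev z0 add0r.
by apply: (simple_generates simS z1 (or_intror o1) smooth_vec_stable); exists n.
Qed.

(** The operator [L_(T+1)] kills the generator, and the vectors on which it is nilpotent form a
    stable subspace; hence it is locally nilpotent. *)
Lemma killed_generator_locally_finite (u : S) (T : nat) :
  (forall P, stable A P -> P u -> forall x, P x) -> killed T u ->
  exists t : nat, (0 < t)%N /\ locally_finite (rL S t%:Z).
Proof.
move=> gen ku; exists T.+1; split=> //.
have sm : forall v, smooth_vec v by apply: gen; [exact: smooth_vec_stable | exists T].
set L := rL S T.+1%:Z; have LE v : L v = X false T.+1%:Z v by [].
have LL : linear L := @rX_lin F S false T.+1%:Z.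
have itL n : linear (iter n L) by elim: n => [|n IH] a x y //; rewrite !iterS IH LL.
have itC n v : iter n L (rc S v) = rc S (iter n L v) by elim: n => //= n ->; rewrite LE -rCX.
pose nil v := exists n, iter n L v = 0.
have sN : subspace nil.
  split=> [|a x y [n xn] [n' yn]]; first by exists 0%N.
  exists (n + n')%N; rewrite itL {1}addnC !iterD xn yn.
  by rewrite !(linP0 (itL _)) scaler0 addr0.
have nC v : nil v -> nil (rc S v).
  by move=> [n vn]; exists n; rewrite itC vn (linP0 (@r_linc F S)).
have nX p m v : nil v -> nil (X p m v).
  move=> [n]; elim: n v m => [|n IH] v m; first by move=> /= ->; exists 0%N; rewrite (linP0 (@rX_lin F S p m)).
  rewrite iterSr => Lv; have [N kN] := sm v.
  (* Inside the induction on the nilpotency order, [k] bounds the number of brackets with [L_(T+1)]: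
     each raises [m], until smoothness of [v] kills the result. *)
  have [k] : exists k : nat, N%:Z < m + k%:Z by exists (N + `|m|).+1; lia.
  elim: k m => [|k IHk] m km.
    by rewrite kN //; [exists 0%N|lia].
  have [j Hj] : nil (L (X p m v)).
    rewrite LE rXX; apply: (subspaceD sN); first apply: (subspaceD sN).
    - by apply: (subspaceZ sN); apply: IH.
    - by apply: (subspaceZ sN); apply: IHk; lia.
    - by apply: (subspaceZ sN); apply: nC; exists n.+1; rewrite iterSr.
  by exists j.+1; rewrite iterSr.
have all_nil : forall v, nil v.
  apply: gen; first by split.
  by exists 1%N => /=; rewrite LE; apply: ku; lia.
move=> v; have [n vn] := all_nil v.
exists [seq iter i L v | i <- iota 0 n] => k _; have [kn|nk] := ltnP k n.
  by apply: in_span_mem; apply/mapP; exists k => //; rewrite mem_iota.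
rewrite -(subnK nk) iterD vn (linP0 (itL _)).
by case: (subspace_in_span [seq iter i L v | i <- iota 0 n]).
Qed.

End Modules.

(** * Locally finite modules are smooth *)

Section LocallyFinite.
Variables (F : numFieldType) (S : RMod F) (t : nat).
Hypothesis t0 : (0 < t)%N.
Hypothesis LF : locally_finite (rL S t%:Z).
Local Notation X := (@rX F S).
Local Notation L := (rL S t%:Z).

(* [[L_m, X_n] = (kp m - n) X_(m+n)]. *)
Definition kp (p : bool) : F := if p then 2%:R^-1 else 1.

Lemma rLX (m n : nat) p v : (0 < m + n)%N ->
  X false m (X p n v) = X p n (X false m v) + (kp p * m%:R - n%:R) *: X p (m + n)%N v.
Proof.
move=> mn; rewrite rXX cz0; last by lia.
rewrite expr0 scale1r scale0r addr0 addFb -PoszD; congr (_ + _ *: _).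
by rewrite /br /kp; case: p; rewrite ?mul1r ?intrB -!pmulrn // [_ / _]mulrC.
Qed.

Lemma kp_neq p (m : nat) : (t < m)%N -> kp p * t%:R - m%:R != 0.
Proof.
move=> tm; rewrite subr_eq0 lt_eqF // (@le_lt_trans _ _ t%:R) ?ltr_nat //.
rewrite ler_piMl ?ler0n // /kp; case: p => //.
by rewrite invf_le1 ?ltr0n // ler1n.
Qed.

Lemma rX_fin_linear p m (I : Type) (r : seq I) (a : I -> F) (g : I -> S) :
  X p m (\sum_(i <- r) a i *: g i) = \sum_(i <- r) a i *: X p m (g i).
Proof.
by rewrite (linP_sum (@rX_lin F S p m)); apply: eq_bigr => i _; rewrite (linPZ (@rX_lin F S p m)).
Qed.

Definition fd (P : S -> Prop) := exists s, forall u, P u -> in_span s u.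

Definition Lfd (P : S -> Prop) := [/\ subspace P, (forall u, P u -> P (L u)) & fd P].

Lemma Lfd_hull (s : seq S) : exists B, Lfd B /\ forall u, u \in s -> B u.
Proof.
have itL n : linear (iter n L) by elim: n => [|n IH] a x y //; rewrite !iterS IH r_linL.
have [s' Hs'] : exists s', forall e, e \in s -> forall n, in_span s' (iter n L e).
  elim: s => [|e s [s' IH]]; first by exists [::].
  (* As [locally_finite] covers only positive iterates, [e] itself is added. *)
  have [se He] := LF e; exists (e :: se ++ s') => x; rewrite inE => /orP[/eqP ->|xs] n.
    case: n => [|n]; first by apply: in_span_mem; rewrite inE eqxx.
    by apply: in_span_sub (He n.+1 _) => // y ys; rewrite inE mem_cat ys orbT.
  by apply: in_span_sub (IH x xs n) => y ys; rewrite inE mem_cat ys !orbT.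
(* Asking for the whole orbit makes the space stable under [L], which the span of [s'] is not known
   to be. *)
exists (fun u => forall n, in_span s' (iter n L u)); split=> //; split.
- split=> [n|a u v Hu Hv n]; first by rewrite (linP0 (itL n)); case: (subspace_in_span s').
  by rewrite itL; apply: (subspace_in_span s').2.
- by move=> u Hu n; rewrite -iterSr.
- by exists s' => u /(_ 0%N).
Qed.

(** Brackets with [L_t] reach every [X_m] with [m > t] from the window [t < m <= 2 t], as their
    coefficients are nonzero by [kp_neq]. So finitely many vectors have to be added. *)
Lemma Lfd_step B : Lfd B -> exists B', [/\ Lfd B', (forall u, B u -> B' u) &
  forall p (m : nat) u, (t < m)%N -> B u -> B' (X p m u)].
Proof.
move=> [sB LB [s Hs]].
pose f p := [seq X p (t.+1 + i)%N e | i <- iota 0 t, e <- s].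
have [B' [[sB' LB' fB'] HB']] := Lfd_hull (s ++ f false ++ f true).
have BB' u : B u -> B' u.
  by move=> /Hs; apply: in_span_min => // e es; apply: HB'; rewrite mem_cat es.
have base p i u : (i < t)%N -> B u -> B' (X p (t.+1 + i)%N u).
  move=> it /Hs; apply: (@in_span_min _ _ s (fun y => B' (X p (t.+1 + i)%N y))).
    exact: (subspace_preim (@rX_lin F S p _) sB').
  move=> e es; apply: HB'; rewrite !mem_cat.
  have : X p (t.+1 + i)%N e \in f p.
    by apply/allpairsP; exists (i, e); rewrite mem_iota.
  by case: p => ->; rewrite !orbT.
exists B'; split=> // p m u tm Bu.
rewrite -(subnKC tm); move: (m - t.+1)%N => i {m tm}.
elim/ltn_ind: i u Bu => i IH u Bu; have [it|ti] := ltnP i t; first exact: base.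
have [i' ei] : exists i', i = (t + i')%N by exists (i - t)%N; rewrite subnKC.
have ii' : (i' < i)%N by rewrite ei; lia.
have := @rLX t (t.+1 + i')%N p u; rewrite ltn_addr // => /(_ isT) H.
have c0 := @kp_neq p (t.+1 + i') (leq_addr _ _).
have -> : (t.+1 + i = t + (t.+1 + i'))%N by rewrite ei; lia.
have {}H : X p (t + (t.+1 + i'))%N u = (kp p * t%:R - (t.+1 + i')%:R)^-1 *:
    (L (X p (t.+1 + i')%N u) - X p (t.+1 + i')%N (L u)).
  by rewrite -[L (X _ _ _)]/(X false t _) H -[L u]/(X false t u) [X in _ *: X]addrC addKr scalerA mulVf ?scale1r.
rewrite H; apply: (subspaceZ sB'); apply: (subspaceB sB').
  by apply: LB'; apply: IH.
by apply: IH => //; apply: LB.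
Qed.

(* Bracketing the relation with [L_t] multiplies [f`_j] by an affine function of [j]: this is [f^`()], up to a shift. *)
Lemma derivative_descent p (Y : S -> Prop) (f : {poly F}) (N0 : nat) :
  (forall u, Y u -> Y (L u)) -> f != 0 ->
  (forall u N, Y u -> (N0 <= N)%N -> \sum_(j < size f) f`_j *: X p (N + j)%N u = 0) ->
  exists N1, forall u N, Y u -> (N1 <= N)%N -> X p N u = 0.
Proof.
move=> LY; move: {2}(size f) (leqnn (size f)) => n.
elim: n f N0 => [|n IH] f N0 fn f0 Hf.
  by move: f0; rewrite -size_poly_leq0 fn.
have [f1|f1] := leqP (size f) 1.
  have sf : size f = 1%N by apply/eqP; rewrite eqn_leq f1 size_poly_gt0.
  exists N0 => u N Yu NN; have := Hf u N Yu NN.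
  rewrite sf big_ord1 addn0 => /eqP; rewrite scaler_eq0 => /orP[|/eqP //].
  by move: f0; rewrite -lead_coef_eq0 /lead_coef sf /= => /negbTE ->.
have [k sk] : exists k, size f = k.+2 by exists (size f).-2; move: f1; case: (size f) => [|[]].
have sd : (size f^`() <= k.+1)%N by rewrite -ltnS -sk lt_size_deriv.
apply: (IH f^`() (N0 + t).+1).
- by apply: leq_trans sd _; rewrite -ltnS -sk.
- have : f^`()`_k != 0.
    by rewrite coef_deriv mulrn_eq0 /= (_ : f`_k.+1 = lead_coef f) ?lead_coef_eq0 // /lead_coef sk.
  by apply: contraNneq => ->; rewrite coef0.
move=> u N Yu NN.
(* The bracket with [L_t] shifts indices by [t], and one more shift comes from the constant
   coefficient, which drops out of the derivative. *)
have [N' eN] : exists N', N = (N' + t).+1 by exists (N - t.-1.+2)%N; lia.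
have N0N' : (N0 <= N')%N by lia.
have H1 : \sum_(j < size f) f`_j *: ((kp p * t%:R - (N' + j)%:R) *: X p (t + (N' + j))%N u) = 0.
  have E := Hf u N' Yu N0N'; have E' := Hf (L u) N' (LY _ Yu) N0N'.
  have := congr1 (X false t) E; rewrite rX_fin_linear (linP0 (@rX_lin F S _ _)).
  under eq_bigr do rewrite rLX ?addn_gt0 ?t0 // scalerDr.
  by rewrite big_split /= -[L u]/(X false t u) in E' *; rewrite E' add0r.
have H2 := Hf u (N' + t)%N Yu (leq_trans N0N' (leq_addr _ _)).
have H3 : \sum_(j < size f) (f`_j * j%:R) *: X p (N' + t + j)%N u = 0.
  have -> : \sum_(j < size f) (f`_j * j%:R) *: X p (N' + t + j)%N u =
      (kp p * t%:R - N'%:R) *: (\sum_(j < size f) f`_j *: X p (N' + t + j)%N u) -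
      \sum_(j < size f) f`_j *: ((kp p * t%:R - (N' + j)%:R) *: X p (t + (N' + j))%N u).
    rewrite scaler_sumr -sumrB; apply: eq_bigr => j _.
    rewrite addnA (addnC t) !scalerA -scalerBl natrD; congr (_ *: _); ring.
  by rewrite H1 H2 scaler0 subr0.
rewrite (sum_coef_widen (fun j => X p (N + j)%N u) sd) -[RHS]H3 sk.
rewrite [RHS]big_ord_recl mulr0 scale0r add0r; apply: eq_bigr => j _.
by rewrite coef_deriv lift0 mulr_natr addnS eN addSn.
Qed.

(** The operators [X_(t+1+j)] map one finite-dimensional space to another, so they are linearly
    dependent there; this is tested on a spanning list inside [Z]. *)
Lemma annihilating_poly p (Z Z' : S -> Prop) : subspace Z -> fd Z -> fd Z' ->
  (forall (m : nat) u, (t < m)%N -> Z u -> Z' (X p m u)) ->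
  exists f : {poly F}, f != 0 /\
    forall u, Z u -> \sum_(j < size f) f`_j *: X p (t.+1 + j)%N u = 0.
Proof.
move=> sZ [s0 Hs0] [s' Hs'] ZZ'.
have [s [sZs Hs]] := inner_span sZ Hs0.
have [|f [f0 _ Hf]] := @poly_dependence _ _ s' (size s) (fun j e => X p (t.+1 + j)%N (nth 0 s e)).
  by move=> j e es; apply: Hs'; apply: ZZ'; [rewrite ltnS leq_addr|apply: sZs; apply: mem_nth].
exists f; split=> // u /Hs; apply: (@in_span_min _ _ s (fun u => \sum_(j < size f) f`_j *: X p (t.+1 + j)%N u = 0)).
  split; first by rewrite big1 // => j _; rewrite (linP0 (@rX_lin F S _ _)) scaler0.
  move=> a x y ex ey; transitivity (a *: (\sum_(j < size f) f`_j *: X p (t.+1 + j)%N x)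
      + \sum_(j < size f) f`_j *: X p (t.+1 + j)%N y); last by rewrite ex ey scaler0 addr0.
  rewrite scaler_sumr -big_split.
  by apply: eq_bigr => j _; rewrite rX_lin scalerDr !scalerA [a * _]mulrC.
by move=> e /(nthP 0)[i si <-]; apply: Hf.
Qed.

Lemma Lfd_killed Y p : Lfd Y -> exists N, forall u n, Y u -> (N <= n)%N -> X p n u = 0.
Proof.
move=> LfdY; have [sY LY _] := LfdY.
(* Two enlargements leave room for two brackets with operators [L_b]; the third provides the
   finite-dimensional target of the relation on [Z2]. *)
have [Z1 [LZ1 YZ1 XYZ1]] := Lfd_step LfdY.
have [Z2 [LZ2 Z12 XZ12]] := Lfd_step LZ1.
have [Z3 [[_ _ fZ3] _ XZ23]] := Lfd_step LZ2.
case: LZ2 => sZ2 _ fZ2.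
have [f [f0 Hf]] := annihilating_poly sZ2 fZ2 fZ3 (XZ23 p).
have bracket1 b w : (t < b)%N -> Z1 w ->
    \sum_(j < size f) f`_j *: ((kp p * b%:R - (t.+1 + j)%:R) *: X p (b + (t.+1 + j))%N w) = 0.
  move=> tb Zw; have := congr1 (X false b) (Hf w (Z12 _ Zw)).
  rewrite rX_fin_linear (linP0 (@rX_lin F S _ _)).
  under eq_bigr do rewrite rLX ?addn_gt0 ?(leq_ltn_trans _ tb) // scalerDr.
  by rewrite big_split /= Hf ?add0r //; apply: (XZ12 false).
have bracket2 b b' u : (t < b)%N -> (t < b')%N -> Y u ->
    \sum_(j < size f) f`_j *: (((kp p * b%:R - (t.+1 + j)%:R) * (kp p * b'%:R - (b + (t.+1 + j))%:R))
       *: X p (b' + (b + (t.+1 + j)))%N u) = 0.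
  move=> tb tb' Yu; have := congr1 (X false b') (bracket1 b u tb (YZ1 _ Yu)).
  under eq_bigr do rewrite scalerA.
  rewrite rX_fin_linear (linP0 (@rX_lin F S _ _)).
  under eq_bigr do rewrite rLX ?addn_gt0 ?(leq_ltn_trans _ tb') // scalerDr -!scalerA.
  rewrite big_split /= bracket1 ?add0r //; last by apply: (XYZ1 false).
  by under eq_bigr do rewrite [X in _ *: X]scalerA.
(* For fixed [b + b'], the second difference in [b] of the coefficients of [bracket2] does not depend on [j]. *)
apply: (@derivative_descent p Y f (3 * t + 7)%N LY f0) => u N Yu NN.
(* The bound [3 t + 7] gives [b' > t], so both indices exceed [t] in each of the splittings
   [(b' + 2) + (t + 1)], [(b' + 1) + (t + 2)] and [b' + (t + 3)] of [N - (t + 1)]. *)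
have [b' eN] : exists b', N = (b' + (t.+3 + t.+1))%N by exists (N - (t.+3 + t.+1))%N; lia.
have tb' : (t < b')%N by lia.
have B0 := @bracket2 t.+1 b'.+2 u (ltnSn t) (ltnW (ltnW (tb' : t.+2 < b'.+2)))%N Yu.
have B1 := @bracket2 t.+2 b'.+1 u (ltnW (ltnSn t.+1)) (ltnW (tb' : t.+1 < b'.+1))%N Yu.
have B2 := @bracket2 t.+3 b' u (ltnW (ltnW (ltnSn t.+2))) tb' Yu.
move: B0 B1 B2; set S0 := (X in X = 0 -> _); set S1 := (X in _ -> X = 0 -> _).
set S2 := (X in _ -> _ -> X = 0 -> _) => B0 B1 B2.
(* This is the second difference: twice the coefficient of [b ^ 2] when [b + b'] is fixed. *)
have k0 : - (2%:R * kp p * (kp p + 1)) != 0 :> F.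
  rewrite oppr_eq0 /kp; case: (p); last by rewrite mulr1 -[1 + 1]/(2%:R) mulf_neq0 ?pnatr_eq0.
  by rewrite mulfV ?pnatr_eq0 // mul1r gt_eqF // addr_gt0 // invr_gt0.
apply/eqP; have : - (2%:R * kp p * (kp p + 1)) *: (\sum_(j < size f) f`_j *: X p (N + j)%N u) == 0.
  have -> : - (2%:R * kp p * (kp p + 1)) *: (\sum_(j < size f) f`_j *: X p (N + j)%N u) =
     S0 - 2%:R *: S1 + S2; last by rewrite B0 B1 B2 scaler0 subr0 addr0.
  rewrite !scaler_sumr -sumrB -big_split /=; apply: eq_bigr => j _.
  rewrite (_ : b'.+2 + (t.+1 + (t.+1 + j)) = N + j)%N; last by lia.
  rewrite (_ : b'.+1 + (t.+2 + (t.+1 + j)) = N + j)%N; last by lia.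
  rewrite (_ : b' + (t.+3 + (t.+1 + j)) = N + j)%N; last by lia.
  rewrite !scalerA -scalerBl -scalerDl; congr (_ *: _).
  rewrite -(addn3 t) -(addn2 t) -(addn1 t) -(addn2 b') -(addn1 b') !natrD; ring.
by rewrite scaler_eq0 (negbTE k0) /=.
Qed.

Lemma locally_finite_smooth : r_simple S -> smooth S.
Proof.
move=> simS; have [v v0] := simS.1.
have [Y [LfdY HY]] := Lfd_hull [:: v].
have Yv : Y v by apply: HY; rewrite inE.
have [N0 H0] := Lfd_killed false LfdY; have [N1 H1] := Lfd_killed true LfdY.
apply: (simple_smooth simS v0); exists (N0 + N1)%N => p [m|m] mN; last by lia.
by case: p; [apply: H1 => //|apply: H0 => //]; lia.
Qed.

End LocallyFinite.

(** * Smooth modules are induced or highest weight modules *)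

Section SubspaceType.
Variables (F : fieldType) (V : lmodType F) (P : V -> Prop).

(** The proof is an argument so that the closure instance can be attached to this constant;
    membership is decided classically. *)
Definition subspace_pred (_ : subspace P) : {pred V} := fun v => `[< P v >].

Variable sP : subspace P.

Lemma subspace_pred_closed : submod_closed (subspace_pred sP).
Proof.
split; first by apply/asboolP; apply: subspace0.
by move=> a u v /asboolP Pu /asboolP Pv; apply/asboolP; apply: sP.2.
Qed.

HB.instance Definition _ := GRing.isSubmodClosed.Build F V (subspace_pred sP) subspace_pred_closed.

Record subsp := SubSp { sub_val :> V; sub_valP : sub_val \in subspace_pred sP }.

HB.instance Definition _ := [isSub for sub_val].
HB.instance Definition _ := [Choice of subsp by <:].
HB.instance Definition _ := [SubChoice_isSubLmodule of subsp by <:].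

Lemma sub_valPP (v : subsp) : P (sub_val v). Proof. exact/asboolP/sub_valP. Qed.

Definition mksub v (Pv : P v) : subsp := SubSp (introT (asboolP _) Pv : v \in subspace_pred sP).

Lemma sub_val_lin : linear sub_val. Proof. exact: (linearP (val : subsp -> V)). Qed.

Lemma sub_val_inj (u v : subsp) : sub_val u = sub_val v -> u = v. Proof. exact: val_inj. Qed.
End SubspaceType.

Section Restriction.
Variables (F : numFieldType) (S : RMod F) (P : S -> Prop) (sP : subspace P).
Hypothesis PX : forall p (m : nat) v, P v -> P (rX p m%:Z v).
Hypothesis PC : forall v, P v -> P (rc S v).
Hypothesis Phom : forall u v, rev S u -> rod S v -> P (u + v) -> P u /\ P v.

Local Notation K := (subsp sP).
Local Notation sv := (@sub_val F S P sP).

Definition resX p (m : nat) (v : K) : K := mksub sP (PX p m (sub_valPP v)).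
Definition resC (v : K) : K := mksub sP (PC (sub_valPP v)).

Lemma res_grading : grading (fun v : K => rev S (sv v)) (fun v : K => rod S (sv v)).
Proof.
have [s0 s1 dec uni] := r_grading S; split.
- exact: (subspace_preim (@sub_val_lin _ _ _ sP) s0).
- exact: (subspace_preim (@sub_val_lin _ _ _ sP) s1).
- move=> v; have [v0 [v1 [e0 o1 ev]]] := dec (sv v).
  have [P0 P1] : P v0 /\ P v1 by apply: Phom => //; rewrite -ev; apply: sub_valPP.
  exists (mksub sP P0), (mksub sP P1); split=> //; apply: sub_val_inj.
  by rewrite (linPD (@sub_val_lin _ _ _ sP)).
- move=> v v0 v1; apply: sub_val_inj; rewrite (linP0 (@sub_val_lin _ _ _ sP)); exact: uni.
Qed.

Lemma resX_lin p m : linear (resX p m).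
Proof. by move=> a u v; apply: sub_val_inj; rewrite [LHS]/= !sub_val_lin rX_lin. Qed.

Lemma resC_lin : linear resC.
Proof. by move=> a u v; apply: sub_val_inj; rewrite [LHS]/= !sub_val_lin r_linc. Qed.

Definition restriction : BMod F.
refine (@Build_BMod F K (fun v => rev S (sv v)) (fun v => rod S (sv v))
  (resX false) (resX true) resC res_grading (resX_lin false) (resX_lin true) resC_lin _ _ _ _ _ _ _ _).
- by move=> m v; apply: r_parL.
- by move=> m v; apply: r_parG.
- by move=> v; apply: r_parc.
- move=> m n v; apply: sub_val_inj; rewrite (linPB (@sub_val_lin _ _ _ sP)).
  by rewrite sub_val_lin (linPZ (@sub_val_lin _ _ _ sP)); exact: r_LL.
- move=> m n v; apply: sub_val_inj; rewrite (linPB (@sub_val_lin _ _ _ sP)).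
  by rewrite (linPZ (@sub_val_lin _ _ _ sP)); exact: r_LG.
- move=> m n v; apply: sub_val_inj; rewrite (linPD (@sub_val_lin _ _ _ sP)).
  by rewrite sub_val_lin (linPZ (@sub_val_lin _ _ _ sP)); exact: r_GG.
- by move=> m v; apply: sub_val_inj; apply: r_cL.
- by move=> m v; apply: sub_val_inj; apply: r_cG.
Defined.

Lemma restriction_val_hom : b_hom (sv : restriction -> S).
Proof. by split=> //; apply: sub_val_lin. Qed.

End Restriction.

Lemma act_prod (F : numFieldType) (M N : lmodType F) (A : action M) (B : action N) w (z : M * N) :
  act (prod_action A B) w z = (act A w z.1, act B w z.2).
Proof. by elim: w => [|a w IH] /=; [case: z|rewrite IH]. Qed.

(** * Positive level: [S] is induced from its killed space *)

Section PositiveLevel.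
Variables (F : numFieldType) (S : RMod F) (t : nat).
Hypothesis simS : r_simple S.
Hypothesis t0 : (0 < t)%N.
Hypothesis ex_killed : exists v : S, v != 0 /\ killed t v.
Hypothesis Linj : forall v : S, killed t v -> rL S t%:Z v = 0 -> v = 0.
Local Notation X := (@rX F S).
Local Notation A := (ract S).

(* [G_t] squares to [0] on the killed space, which is why its kernel has to be placed one step lower. *)
Definition Vfilt (e : int) (v : S) : Prop :=
  if e < 0 then v = 0 else if e == 0 then killed t v /\ X true t v = 0 else killed t v.

Lemma Vfilt_killed e v : Vfilt e v -> killed t v.
Proof.
rewrite /Vfilt; case: ifP => [_ ->|_]; first exact: (subspace0 (killed_subspace S t)).
by case: ifP => [_ []|].
Qed.

Lemma killed_Vfilt v : killed t v -> Vfilt 1 v. Proof. by []. Qed.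

Lemma Vfilt_subspace e : subspace (Vfilt e).
Proof.
rewrite /Vfilt; case: (e < 0); first by split=> [//|a u v eu ev]; rewrite eu ev scaler0 addr0.
case: (e == 0); last exact: (killed_subspace S t).
split; first by split; [exact: (subspace0 (killed_subspace S t))|apply: (linP0 (@rX_lin F S true _))].
move=> a u v [ku eu] [kv ev]; split; first exact: (killed_subspace S t).2.
by rewrite rX_lin eu ev scaler0 addr0.
Qed.

Lemma Vfilt_mono e e' v : e <= e' -> Vfilt e v -> Vfilt e' v.
Proof.
move=> ee'; have [e0|e0] := ltP e 0.
  rewrite {1}/Vfilt e0 => ->; exact: (subspace0 (Vfilt_subspace e')).
have [e1|e1] := eqVneq e 0.
  rewrite {1}/Vfilt e1 ltxx eqxx => -[kv gv]; rewrite /Vfilt.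
  by rewrite (_ : (e' < 0) = false); [case: ifP|lia].
move=> /Vfilt_killed kv; rewrite /Vfilt.
by rewrite (_ : (e' < 0) = false) 1?(_ : (e' == 0) = false) //; lia.
Qed.

Lemma Vfilt_neg e v : e < 0 -> Vfilt e v -> v = 0.
Proof. by rewrite /Vfilt => ->. Qed.

Lemma Vfilt_zero v : Vfilt 0 v <-> killed t v /\ X true t v = 0.
Proof. by rewrite /Vfilt. Qed.

Lemma Vfilt_pos e v : 0 < e -> killed t v -> Vfilt e v.
Proof. by move=> e0 kv; apply: (@Vfilt_mono 1); [lia|exact: killed_Vfilt]. Qed.

Lemma Vfilt_C e v : Vfilt e v -> Vfilt e (rc S v).
Proof.
have C0 : rc S 0 = 0 by apply: (linP0 (@r_linc F S)).
rewrite /Vfilt; case: ifP => [_ ->|_] //; case: ifP => [_ [kv gv]|_]; last exact: killed_rc.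
by split; [exact: killed_rc|rewrite -rCX gv].
Qed.

(** The square of [G_t] is [L_(2t)], and [2 t > t]. *)
Lemma Gt_sqr v : killed t v -> X true t (X true t v) = 0.
Proof.
move=> kv; apply/eqP; have := rXX true true t t v; rewrite cz0; last by lia.
rewrite addbb andbb expr1 scale0r addr0 (kv false); last by lia.
rewrite scaler0 addr0 scaleN1r => /eqP; rewrite -addr_eq0 -mulr2n -scaler_nat scaler_eq0.
by rewrite pnatr_eq0.
Qed.

(** Only [G_0] can leave the kernel of [G_t], its bracket with [G_t] being [2 L_t]. The bracket of
    [L_0] with [G_t] is a multiple of [G_t], and for [m > 0] the bracket has degree above [t]. *)
Lemma Vfilt_X p m e v : 0 <= m -> m <= t%:Z -> Vfilt e v -> Vfilt (e + gw t p m) (X p m v).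
Proof.
move=> m0 mt Vv; have [e0|e0] := ltP e 0.
  rewrite (Vfilt_neg e0 Vv) (linP0 (@rX_lin F S p m)).
  exact: (subspace0 (Vfilt_subspace _)).
have kv := Vfilt_killed Vv; have kX q k : 0 <= k -> killed t (X q k v) by move=> k0; apply: killed_nonneg.
have [e1|e1] := eqVneq e 0.
  move: Vv; rewrite e1 => /Vfilt_zero [_ gv]; rewrite add0r.
  have Gcomm : (p, m) != (true, 0) -> X true t (X p m v) = 0.
    move=> pm; have [m1|m1] := eqVneq m 0.
      move: pm; rewrite m1; case: (p) => // _.
      rewrite rXX cz0; last by lia.
      by rewrite addbF addr0 !gv (linP0 (@rX_lin F S _ _)) !scaler0 scale0r !addr0.
    rewrite rXX cz0; last by lia.
    rewrite gv (linP0 (@rX_lin F S _ _)) !scaler0 scale0r add0r addr0 (_ : X _ _ v = 0) ?scaler0 //.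
    by apply: kv; lia.
  have [pm|pm] := eqVneq (p, m) (true, 0).
    case: pm => -> ->; rewrite /gw (_ : (t == 0%N) = false) /= ?eqxx; last by lia.
    by apply: Vfilt_pos => //; apply: (kX true).
  have := Gcomm pm; rewrite /gw (_ : (t == 0%N) = false); last by lia.
  case: p pm {Gcomm} => /= pm Gc; last by apply/Vfilt_zero; split=> //; apply: (kX false).
  have -> : (m == 0) = false by apply: contraNF pm => /eqP ->.
  case: eqP => [-> |_]; last by apply/Vfilt_zero; split=> //; apply: (kX true).
  by rewrite (gv : rG S t%:Z v = 0); apply: (subspace0 (Vfilt_subspace _)).
rewrite /gw (_ : (t == 0%N) = false); last by lia.
case: p => /=; last by rewrite addr0; apply: Vfilt_pos; [lia|apply: (kX false)].
case: eqP => _; first by apply: Vfilt_pos; [lia|apply: (kX true)].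
case: eqP => [->|_]; last by apply: Vfilt_pos; [lia|apply: (kX true)].
have : Vfilt 0 (X true t v) by apply/Vfilt_zero; split; [apply: (kX true)|apply: Gt_sqr].
by apply: Vfilt_mono; lia.
Qed.

Lemma Vfilt_X0 p m e v : t%:Z < m -> Vfilt e v -> X p m v = 0.
Proof. by move=> tm /Vfilt_killed; apply. Qed.

Lemma Lt_Gt v : killed t v -> X true t (X false t v) = X false t (X true t v).
Proof.
move=> kv; rewrite rXX cz0; last by lia.
by rewrite andbF expr0 scale1r scale0r addr0 addbF (kv true (t%:Z + t%:Z)) ?scaler0 ?addr0 //; lia.
Qed.

(** At [e = 1], where [G_t (L_t v) = 0]: the two operators commute on the killed space and [L_t] is
    injective there, whence [G_t v = 0]. *)
Lemma Vfilt_inj e v : Vfilt e v -> Vfilt (e + tau t - 1) (X false t v) -> Vfilt (e - 1) v.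
Proof.
rewrite /tau (_ : (t == 0%N) = false) ?addr0; last by lia.
move=> Vv; have kv := Vfilt_killed Vv; have [e0|e0] := ltP e 1.
  have [e1|e1] := ltP e 0; first by rewrite (Vfilt_neg e1 Vv) => _; apply: (subspace0 (Vfilt_subspace _)).
  move=> H; have -> : v = 0 by apply: (Linj kv); apply: Vfilt_neg H; lia.
  exact: (subspace0 (Vfilt_subspace _)).
have [e1|e1] := eqVneq e 1; last by move=> _; apply: Vfilt_pos => //; lia.
rewrite e1 subrr => /Vfilt_zero [_ H]; apply/Vfilt_zero; split=> //.
by apply: Linj; [apply: killed_nonneg|rewrite -[LHS]/(X false t _) -Lt_Gt].
Qed.

Lemma killed_exhausted (v : S) : killed t v -> exhausted Vfilt v.
Proof. by exists 1. Qed.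

Definition base : BMod F :=
  restriction (killed_subspace S t) (fun p (m : nat) v => killed_nonneg p (le0z_nat m) (v:=v))
    (@killed_rc _ S t) (@killed_homog _ S t).

Definition incl : base -> S := @sub_val F S _ (killed_subspace S t).

Lemma incl_lin : linear incl. Proof. exact: sub_val_lin. Qed.
Lemma incl_killed v : killed t (incl v). Proof. exact: sub_valPP. Qed.
Lemma incl_inj u v : incl u = incl v -> u = v. Proof. exact: sub_val_inj. Qed.
Lemma incl_X p (m : nat) v : incl (if p then bG base m v else bL base m v) = X p m (incl v).
Proof. by case: p. Qed.

Lemma killed_incl x : killed t x -> exists v, incl v = x.
Proof. by move=> kx; exists (mksub _ kx). Qed.

Lemma base_homog (W : base -> Prop) : b_submodule W -> (exists v, W v /\ v <> 0) ->
  exists v, [/\ W v, incl v != 0 & rev S (incl v) \/ rod S (incl v)].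
Proof.
move=> [sW _ _ hW] [v [Wv v0]]; have [v1 [v2 [e1 o2 W1 W2 ev]]] := hW v Wv.
have I0 u : u <> 0 -> incl u != 0.
  by move=> u0; apply/eqP => h; apply: u0; apply: incl_inj; rewrite h (linP0 incl_lin).
have [h1|h1] := pselect (v1 = 0); last by exists v1; split; [|apply: I0|left].
exists v2; split=> //; last by right.
by apply: I0 => h2; apply: v0; rewrite ev h1 h2 addr0.
Qed.

Lemma full_submodule : b_submodule (fun _ : base => True).
Proof.
split=> // w _; have [_ _ dec _] := b_grading base.
by have [w0 [w1 [? ? ?]]] := dec w; exists w0, w1.
Qed.

Lemma base_nonzero : exists v : base, True /\ v <> 0.
Proof.
have [v [v0 kv]] := ex_killed; have [u eu] := killed_incl kv.
exists u; split=> // u0; move: v0; rewrite -eu u0 (linP0 incl_lin); by rewrite eqxx.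
Qed.

Lemma base_generates P : stable A P -> (forall v : base, P (incl v)) -> forall x, P x.
Proof.
move=> stP HP; have [v [_ v0 hv]] := base_homog full_submodule base_nonzero.
exact: (simple_generates simS v0 hv stP).
Qed.

(** A nonzero submodule [W] contains a nonzero homogeneous vector, which generates [S]; by
    [sspan_cap], what [W] generates meets the killed space only in [W]. *)
Lemma base_simple : b_simple base.
Proof.
split; first by have [v [_ v0]] := base_nonzero; exists v; apply/eqP.
move=> W sW; have [[v [Wv v0]]|nW] := pselect (exists v, W v /\ v <> 0); last first.
  by left=> w Ww; have [//|w0] := pselect (w = 0); case: nW; exists w.
right=> x; have [u [Wu u0 hu]] := base_homog sW (ex_intro _ v (conj Wv v0)).
have [ssW WX WC _] := sW.
pose U (z : S) := exists w, W w /\ incl w = z.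
have sU : subspace U.
  split; first by exists 0; split; [case: ssW|apply: (linP0 incl_lin)].
  move=> a _ _ [w [Ww <-]] [w' [Ww' <-]]; exists (a *: w + w').
  by split; [apply: ssW.2|apply: incl_lin].
have UX p m z : 0 <= m -> U z -> U (aX A p m z).
  case: m => // m _ [w [Ww <-]]; exists (if p then bG base m w else bL base m w).
  by split; [case: (p); [exact: (WX m w Ww).2|exact: (WX m w Ww).1]|rewrite incl_X].
have UC z : U z -> U (aC A z).
  by move=> [w [Ww <-]]; exists (bc base w); split; [apply: WC|].
have allU : sspan A U (incl x).
  apply: (simple_generates simS u0 hu (sspan_stable UX UC)).
  by apply: (@wspan_incl _ _ _ _ (sorted nle) [::]) => //; exists u.
have [w [Ww ew]] : U (incl x).
  apply: (sspan_cap (A:=A) Vfilt_subspace Vfilt_mono Vfilt_neg Vfilt_X Vfilt_X0 Vfilt_C Vfilt_inj sU _ _ allU).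
    by move=> _ [w [_ <-]]; apply: killed_exhausted; apply: incl_killed.
  by apply: killed_exhausted; apply: incl_killed.
by rewrite -(incl_inj ew).
Qed.

Section Universal.
Variables (N : RMod F) (f : base -> N).
Hypothesis fH : b_hom f.
Local Notation AB := (prod_action A (ract N)).

Let flin : linear f. Proof. by case: fH. Qed.

Definition graph0 (z : (S * N)%type) : Prop := exists v, z = (incl v, f v).
Definition graph (x : S) (y : N) : Prop := sspan AB graph0 (x, y).

Lemma graph0_subspace : subspace graph0.
Proof.
split; first by exists 0; rewrite (linP0 incl_lin) (linP0 flin).
by move=> a _ _ [v ->] [v' ->]; exists (a *: v + v'); rewrite incl_lin flin.
Qed.

Lemma graph_stable : stable AB (sspan AB graph0).
Proof.
have [_ _ fX fC] := fH; apply: sspan_stable.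
  move=> p [m|//] z _ [v ->]; exists (if p then bG base m v else bL base m v).
  rewrite incl_X /= /pX /=; congr (_, _).
  by case: p; rewrite ?(fX m v).1 ?(fX m v).2.
by move=> _ [v ->]; exists (bc base v); rewrite fC.
Qed.

Lemma graph_incl v : graph (incl v) (f v).
Proof. by apply: (@wspan_incl _ _ _ _ (sorted nle) [::]) => //; exists v. Qed.

(** A sum of ordered monomials vanishing in [S] has zero coefficients by independence, so its second
    component vanishes too. This is where freeness of the induced module enters. *)
Lemma graph_functional y : graph 0 y -> y = 0.
Proof.
move=> /(sspan_sorted_sum graph0_subspace) [s [g [us ss Hg e]]].
have e1 : \sum_(w <- s) act A w (g w).1 = 0.
  rewrite [RHS](congr1 fst e) (big_morph fst (id1 := 0) (op1 := +%R)) //.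
  by apply: eq_bigr => w _; rewrite act_prod.
have e2 : y = \sum_(w <- s) act (ract N) w (g w).2.
  rewrite [LHS](congr1 snd e) (big_morph snd (id1 := 0) (op1 := +%R)) //.
  by apply: eq_bigr => w _; rewrite act_prod.
have H : forall w, w \in s -> (g w).1 = 0.
  apply: (independent_fun (A:=A) Vfilt_subspace Vfilt_mono Vfilt_neg Vfilt_X Vfilt_X0 Vfilt_C Vfilt_inj us ss _ e1).
  by move=> w; have [v ->] := Hg w; apply: killed_exhausted; apply: incl_killed.
rewrite e2 big_seq big1 // => w /H; have [v ->] := Hg w => /= v0.
have -> : v = 0 by apply: incl_inj; rewrite v0 (linP0 incl_lin).
by rewrite (linP0 flin) (linP0 (@act_lin _ _ (ract N) w)).
Qed.

Lemma graph_total x : exists y, graph x y.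
Proof.
have [sG GX GC] := graph_stable.
apply: (@base_generates (fun x => exists y, graph x y)) => [|v]; last by exists (f v); apply: graph_incl.
split=> [|p m u [y G]|u [y G]].
- split; first by exists 0; apply: (subspace0 sG).
  by move=> a u v [y G] [y' G']; exists (a *: y + y'); apply: (sG.2 a (u, y) (v, y')).
- by exists (aX (ract N) p m y); apply: (GX p m (u, y)).
- by exists (aC (ract N) y); apply: (GC (u, y)).
Qed.

Lemma induced_map : exists g : S -> N, [/\ r_hom g, (forall v, g (incl v) = f v) &
  forall g' : S -> N, r_hom g' -> (forall v, g' (incl v) = f v) -> forall x, g' x = g x].
Proof.
have [_ fpar _ _] := fH.
have [g Hg] := choice graph_total; have [sG GX GC] := graph_stable.
have guniq x y : graph x y -> g x = y.
  move=> G; apply/eqP; rewrite -subr_eq0; apply/eqP; apply: graph_functional.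
  have : sspan AB graph0 (x - x, g x - y) := subspaceB sG (Hg x) G.
  by rewrite subrr; apply.
have glin : linear g.
  by move=> a u v; apply: guniq; exact: (sG.2 a (u, g u) (v, g v) (Hg u) (Hg v)).
have gX p m u : g (X p m u) = aX (ract N) p m (g u).
  by apply: guniq; exact: (GX p m (u, g u) (Hg u)).
have gC u : g (rc S u) = rc N (g u) by apply: guniq; exact: (GC (u, g u) (Hg u)).
have gI v : g (incl v) = f v by apply: guniq; apply: graph_incl.
have [t0' t1' _ tu] := r_grading N; have [s0' s1' _ su] := r_grading S.
(* Stable subspaces carry no grading, so parity is propagated separately: the vectors having
   homogeneous components whose parity [g] preserves form a stable subspace containing [base]. *)
have gpar x : exists x0 x1, [/\ rev S x0, rod S x1, x = x0 + x1, rev N (g x0) & rod N (g x1)].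
  move: x; apply: (@base_generates (fun x => exists x0 x1,
     [/\ rev S x0, rod S x1, x = x0 + x1, rev N (g x0) & rod N (g x1)])); last first.
    move=> v; have [_ _ dec _] := b_grading base; have [v0 [v1 [h0 h1 ->]]] := dec v.
    exists (incl v0), (incl v1); rewrite !gI; split=> //; [exact: (fpar v0).1|exact: (fpar v1).2].
  split.
  - split; first by exists 0, 0; rewrite (linP0 glin) addr0; split=> //; apply: subspace0.
    move=> a _ _ [x0 [x1 [h0 h1 -> k0 k1]]] [y0 [y1 [i0 i1 -> l0 l1]]].
    exists (a *: x0 + y0), (a *: x1 + y1); rewrite !glin; split;
      [exact: s0'.2|exact: s1'.2| |exact: t0'.2|exact: t1'.2].
    by rewrite scalerDr addrACA.
  - move=> p m _ [x0 [x1 [h0 h1 -> k0 k1]]].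
    have h0' := (rX_homog p m x0).1 h0; have h1' := (rX_homog p m x1).2 h1.
    have k0' := (rX_homog p m (g x0)).1 k0; have k1' := (rX_homog p m (g x1)).2 k1.
    rewrite -[aX A p m _]/(X p m (x0 + x1)) (linPD (@rX_lin F S p m)).
    case: p h0' h1' k0' k1' => h0' h1' k0' k1'.
      by exists (X true m x1), (X true m x0); rewrite !gX; split=> //; rewrite addrC.
    by exists (X false m x0), (X false m x1); rewrite !gX.
  - move=> _ [x0 [x1 [h0 h1 -> k0 k1]]]; exists (rc S x0), (rc S x1).
    rewrite !gC; split; [exact: (r_parc _).1|exact: (r_parc _).2| |exact: (r_parc _).1|exact: (r_parc _).2].
    exact: (linPD (@r_linc F S)).
exists g; split=> //; last first.
  move=> g' [g'lin _ g'X g'C] g'I; apply: base_generates => [|v]; last by rewrite g'I gI.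
  split=> [|p m u e|u e].
  - split; first by rewrite (linP0 g'lin) (linP0 glin).
    by move=> a u v eu ev; rewrite g'lin glin eu ev.
  - by rewrite gX -e; case: p; rewrite /= ?(g'X m u).1 ?(g'X m u).2.
  - by rewrite -[aC A u]/(rc S u) g'C gC e.
split=> //; last by move=> m v; split; [apply: (gX false)|apply: (gX true)].
move=> v; have [x0 [x1 [h0 h1 -> k0 k1]]] := gpar v; split=> h.
- have x10 : x1 = 0.
    by apply: su => //; rewrite -[x1](addKr x0); apply: (subspaceD s0') => //; apply: (subspaceN s0').
  by rewrite x10 addr0.
- have x00 : x0 = 0.
    by apply: su => //; rewrite -[x0](addrK x1); apply: (subspaceB s1').
  by rewrite x00 add0r.
Qed.
End Universal.

Lemma positive_level : exists (V : BMod F) (M : RMod F) (iota : V -> M),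
  [/\ b_simple V, exists t : nat, [/\ (0 < t)%N, injective (bL V t) &
        forall i : nat, (t < i)%N -> forall v, bL V i v = 0],
      is_induced iota & r_iso S M].
Proof.
exists base, S, incl; split.
- exact: base_simple.
- exists t; split=> // [u v e|i ti v]; last first.
    by apply: incl_inj; rewrite (incl_X false) (linP0 incl_lin); apply: incl_killed; lia.
  apply: incl_inj; apply/eqP; rewrite -subr_eq0 -(linPB incl_lin); apply/eqP.
  apply: Linj; first exact: incl_killed.
  by rewrite (linPB incl_lin) -[rL S t]/(X false t) (linPB (@rX_lin F S _ _)) -!(incl_X false) e subrr.
- split; first exact: restriction_val_hom.
  by move=> N f fH; apply: induced_map.
- by exists id; split; [|exists id].
Qed.

End PositiveLevel.

(** * Polynomials in a linear operator and eigenvectors *)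

Section PolynomialsInAnOperator.
Variables (F : numClosedFieldType) (V : lmodType F) (x : V -> V).
Hypothesis xL : linear x.

Definition peval (p : {poly F}) (v : V) : V := \sum_(i < size p) p`_i *: iter i x v.

Lemma peval_widen n (p : {poly F}) v : (size p <= n)%N -> peval p v = \sum_(i < n) p`_i *: iter i x v.
Proof. exact: (sum_coef_widen (fun i => iter i x v)). Qed.

Lemma iter_lin n : linear (iter n x).
Proof. by elim: n => [|n IH] a u v //; rewrite !iterS IH xL. Qed.

Lemma peval_lin p : linear (peval p).
Proof.
move=> a u v; rewrite /peval scaler_sumr -big_split; apply: eq_bigr => i _.
by rewrite iter_lin scalerDr !scalerA [a * _]mulrC.
Qed.

Lemma peval_linl v : linear (peval^~ v).
Proof.
move=> a p q; pose n := maxn (size (a *: p + q)) (maxn (size p) (size q)).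
rewrite !(@peval_widen n) /n ?leq_max ?leqnn ?orbT // scaler_sumr -big_split.
by apply: eq_bigr => i _; rewrite coefD coefZ scalerDl scalerA.
Qed.

Lemma peval1 v : peval 1 v = v.
Proof. by rewrite (@peval_widen 1) ?size_poly1 // big_ord1 coef1 scale1r. Qed.

Lemma pevalXM p v : peval ('X * p) v = x (peval p v).
Proof.
rewrite (@peval_widen (size p).+1); last first.
  by rewrite mulrC; apply: leq_trans (size_polyMleq _ _) _; rewrite size_polyX addn2.
rewrite big_ord_recl coefXM scale0r add0r (linP_sum xL); apply: eq_bigr => i _.
by rewrite coefXM lift0 /= (linPZ xL).
Qed.

Lemma pevalXsubM a p v : peval (('X - a%:P) * p) v = x (peval p v) - a *: peval p v.
Proof.
rewrite mulrBl mul_polyC (linPB (peval_linl v)) (linPZ (peval_linl v)).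
by rewrite pevalXM.
Qed.

Lemma peval_comm p v : x (peval p v) = peval p (x v).
Proof.
rewrite /peval (linP_sum xL); apply: eq_bigr => i _.
by rewrite (linPZ xL) -iterS iterSr.
Qed.

Lemma peval_stable (P : V -> Prop) p v : subspace P -> (forall u, P u -> P (x u)) -> P v -> P (peval p v).
Proof.
move=> sP Px Pv; apply: subspace_sum => // i _; apply: subspaceZ => //.
by elim: (i : nat) => // n; apply: Px.
Qed.

(** The linear factors of [p] are applied to [v] one by one; the factor that first gives [0]
    exhibits an eigenvector. *)
Lemma peval_eigen (P : V -> Prop) p v : subspace P -> (forall u, P u -> P (x u)) -> P v ->
  v != 0 -> p != 0 -> peval p v = 0 -> exists mu u, [/\ P u, u != 0 & x u = mu *: u].
Proof.
move=> sP Px Pv v0 p0; have [r er] := closed_field_poly_normal p; rewrite er.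
rewrite (linPZ (peval_linl v)) => /eqP; rewrite scaler_eq0 lead_coef_eq0 (negbTE p0) /=.
elim: r {er} => [|z r IH]; first by rewrite big_nil peval1 (negbTE v0).
rewrite big_cons pevalXsubM; set u := peval _ v.
have [u0 _|u0] := eqVneq u 0; first by apply: IH; rewrite -/u u0.
rewrite subr_eq0 => /eqP e; exists z, u; split=> //.
exact: peval_stable.
Qed.

(* The vectors [(x - a)^-1 v], for uncountably many [a], cannot all be independent. *)
Lemma countable_dim_eigenvalue (e : nat -> V) (v : V) :
  (forall h : F -> nat, exists n, forall k, exists s : seq F,
     [/\ uniq s, size s = k & forall z, z \in s -> h z = n]) ->
  (forall u, exists N, in_span [seq e i | i <- iota 0 N] u) ->
  (forall a u, exists w, x w - a *: w = u) -> v != 0 ->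
  exists mu u, u != 0 /\ x u = mu *: u.
Proof.
move=> unc espan surj v0.
have [inv Hinv] := choice (fun a => surj a v).
have [h Hh] := choice (fun a => espan (inv a)).
(* These are [n + 1] scalars whose inverse vectors all lie in the span of the first [n] vectors
   [e i]. *)
have [n Hn] := unc h; have [s [us ss hs]] := Hn n.+1.
set l := [seq e i | i <- iota 0 n]; have sl : size l = n by rewrite size_map size_iota.
(* The default [head 0 s] keeps indices beyond the list inside the fibre, since [poly_dependence]
   asks for all [j]. *)
have inl j : in_span l (inv (nth (head 0 s) s j)).
  have s0 : head 0 s \in s by case: (s) ss => // a s' _; rewrite inE eqxx.
  have := Hh (nth (head 0 s) s j); rewrite hs //.
  have [js|js] := ltnP j (size s); first exact: mem_nth.
  by rewrite nth_default.
have [|f [f0 sf Hf]] := @poly_dependence _ _ l 1 (fun j _ => inv (nth (head 0 s) s j)); first by [].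
rewrite mul1n sl in sf; have {}Hf := Hf 0%N isT.
rewrite (sum_coef_widen (fun j => inv (nth (head 0 s) s j)) sf) in Hf.
pose a (j : 'I_n.+1) := nth (head 0 s) s j.
have ainj i j : a i = a j -> i = j.
  by move=> /eqP; rewrite nth_uniq ?ss ?ltn_ord // => /eqP /val_inj.
pose Q j := \prod_(i < n.+1 | i != j) ('X - (a i)%:P).
(* The dependence with denominators cleared. At [a j] only the [j]-th term survives, as in Lagrange
   interpolation, so [P] is nonzero. *)
pose P := \sum_(j < n.+1) f`_j *: Q j.
have P0 : P != 0.
  have [j fj] : exists j : 'I_n.+1, f`_j != 0.
    have lt : ((size f).-1 < n.+1)%N by move: sf f0; rewrite -size_poly_gt0; lia.
    by exists (Ordinal lt); rewrite /= -/(lead_coef f) lead_coef_eq0.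
  have PE : P.[a j] = f`_j * (Q j).[a j].
    rewrite horner_sum (bigD1 j) //= hornerZ [X in _ + X]big1 ?addr0 // => i ij.
    by rewrite hornerZ horner_prod (bigD1 j) 1?eq_sym //= hornerXsubC subrr mul0r mulr0.
  apply: contraNneq fj => P0; move: PE; rewrite P0 horner0 => /esym/eqP.
  rewrite mulf_eq0 => /orP[//|]; rewrite horner_prod prodf_seq_eq0 => /hasP[i _ /andP[ij]].
  by rewrite hornerXsubC subr_eq0 => /eqP /ainj e0; rewrite e0 eqxx in ij.
have [mu [u [_ u0 xu]]] : exists mu u, [/\ True, u != 0 & x u = mu *: u]; last by exists mu, u.
apply: (@peval_eigen (fun _ => True) P v) => //.
rewrite (linP_sum (peval_linl v)); under eq_bigr do rewrite (linPZ (peval_linl v)).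
transitivity (\sum_(j < n.+1) f`_j *: peval (\prod_(i < n.+1) ('X - (a i)%:P)) (inv (a j))).
  apply: eq_bigr => j _; rewrite (bigD1 j) //= -/(Q j) pevalXsubM peval_comm.
  congr (_ *: _); by rewrite -(linPZ (peval_lin _)) -(linPB (peval_lin _)) Hinv.
under eq_bigr do rewrite -(linPZ (peval_lin _)).
by rewrite -(linP_sum (peval_lin _)) Hf (linP0 (peval_lin _)).
Qed.

End PolynomialsInAnOperator.

(** * The central character *)

Section CentralCharacter.
Variables (F : numClosedFieldType) (S : RMod F).
Hypothesis simS : r_simple S.
Hypothesis unc : forall h : F -> nat, exists n, forall k, exists s : seq F,
  [/\ uniq s, size s = k & forall z, z \in s -> h z = n].
Local Notation A := (ract S).
Local Notation clin := (@r_linc F S).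

Lemma homog_nonzero (P : S -> Prop) (u : S) :
  (forall v0 v1, rev S v0 -> rod S v1 -> P (v0 + v1) -> P v0 /\ P v1) -> P u -> u != 0 ->
  exists v, [/\ P v, v != 0 & rev S v \/ rod S v].
Proof.
move=> Ph Pu u0; have [v0 [v1 [e0 o1 eu]]] := homog_decomp u.
have [P0 P1] : P v0 /\ P v1 by apply: Ph => //; rewrite -eu.
have [z0|z0] := eqVneq v0 0; last by exists v0; split=> //; left.
by exists v1; split=> //; [move: u0; rewrite eu z0 add0r|right].
Qed.

(** Words in all generators, [None] standing for [c]. They form a countable type, hence [pickle]
    enumerates a spanning family. *)
Definition actw (w : seq (option (bool * int))) (v : S) : S :=
  foldr (fun g u => if g is Some pm then rX pm.1 pm.2 u else rc S u) v w.

Lemma countable_span : exists e : nat -> S, forall u, exists N, in_span [seq e i | i <- iota 0 N] u.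
Proof.
have [u u0] := simS.1.
have [v [_ v0 hv]] := @homog_nonzero (fun _ => True) u (fun _ _ _ _ _ => conj I I) I u0.
pose e n := if unpickle n is Some w then actw w v else 0; exists e.
pose P u := exists N, in_span [seq e i | i <- iota 0 N] u.
have mono N N' y : (N <= N')%N -> in_span [seq e i | i <- iota 0 N] y -> in_span [seq e i | i <- iota 0 N'] y.
  move=> NN'; apply: in_span_sub => _ /mapP[i iN ->]; apply: map_f.
  by move: iN; rewrite !mem_iota !add0n => /andP[_ iN]; apply: leq_trans NN'.
have sP : subspace P.
  split; first by exists 0%N; case: (subspace_in_span [seq e i | i <- iota 0 0]).
  move=> a y z [N Hy] [N' Hz]; exists (maxn N N'); apply: (subspace_in_span _).2.
    by apply: mono Hy; apply: leq_maxl.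
  by apply: mono Hz; apply: leq_maxr.
have Pw w : P (actw w v).
  exists (pickle w).+1; apply: in_span_mem; apply/mapP; exists (pickle w); first by rewrite mem_iota ltnS leqnn.
  by rewrite /e pickleK.
have Pe (f : S -> S) g : linear f -> (forall w, f (actw w v) = actw (g :: w) v) -> forall y, P y -> P (f y).
  move=> fL fw y [N]; apply: (@in_span_min _ _ _ (fun y => P (f y))); first exact: (subspace_preim fL sP).
  move=> _ /mapP[i _ ->]; rewrite /e; case: unpickle => [w|]; first by rewrite fw.
  by rewrite (linP0 fL); case: sP.
apply: (simple_generates simS v0 hv); last exact: (Pw [::]).
split=> //; first by move=> p m; apply: (Pe _ (Some (p, m))) => //; apply: rX_lin.
by apply: (Pe _ None) => //; apply: clin.
Qed.

(** If [c] is not a scalar, every [c - a] has nonzero, hence full, image. Then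
    [countable_dim_eigenvalue] provides an eigenvector, and by simplicity its eigenspace is all of
    [S]. *)
Lemma central_scalar : exists l : F, forall v : S, rc S v = l *: v.
Proof.
have [u0 hu0] := simS.1; apply: contrapT => ns.
have nz a : exists u, rc S u - a *: u != 0.
  apply: contrapT => H; apply: ns; exists a => v; apply/eqP; rewrite -subr_eq0.
  by apply/negP => /negP h; apply: H; exists v.
have dlin a : linear (fun u => rc S u - a *: u).
  move=> b u v /=; rewrite clin scalerDr opprD addrACA scalerBr !scalerA [a * b]mulrC //.
have dX a p m u : rc S (rX p m u) - a *: rX p m u = rX p m (rc S u - a *: u).
  by rewrite (linPB (@rX_lin F S p m)) (linPZ (@rX_lin F S p m)) rCX.
have dC a u : rc S (rc S u) - a *: rc S u = rc S (rc S u - a *: u).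
  by rewrite (linPB clin) (linPZ clin).
have dh a v : rev S v \/ rod S v -> rev S (rc S v - a *: v) \/ rod S (rc S v - a *: v).
  have [s0 s1 _ _] := r_grading S.
  move=> [h|h]; [left; apply: (subspaceB s0)|right; apply: (subspaceB s1)].
  - exact: (r_parc _).1.
  - exact: (subspaceZ s0).
  - exact: (r_parc _).2.
  - exact: (subspaceZ s1).
have surj a u : exists w, rc S w - a *: w = u.
  have [y hy] := nz a; have [y0 [y1 [e0 o1 ey]]] := homog_decomp y.
  have [z [z0 hz]] : exists z, rc S z - a *: z != 0 /\ (rev S z \/ rod S z).
    have [h|h] := eqVneq (rc S y0 - a *: y0) 0; last by exists y0; split=> //; left.
    exists y1; split; last by right.
    by move: hy; rewrite ey (linPD (dlin a)) h add0r.
  apply: (simple_generates (P := fun u => exists w, rc S w - a *: w = u) simS z0 (dh a z hz)); last by exists z.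
  split.
  - split; first by exists 0; apply: (linP0 (dlin a)).
    by move=> b _ _ [w1 <-] [w2 <-]; exists (b *: w1 + w2); apply: (dlin a).
  - by move=> p m _ [w <-]; exists (rX p m w); apply: dX.
  - by move=> _ [w <-]; exists (rc S w); apply: dC.
have [e He] := countable_span.
have [mu [u [un cu]]] := countable_dim_eigenvalue clin unc He surj hu0.
have kh v0 v1 : rev S v0 -> rod S v1 -> rc S (v0 + v1) = mu *: (v0 + v1) ->
    rc S v0 = mu *: v0 /\ rc S v1 = mu *: v1.
  move=> e0 o1 /eqP; rewrite -subr_eq0 (linPD (dlin mu)) => /eqP.
  have [s0 s1 _ _] := r_grading S.
  have E : rev S (rc S v0 - mu *: v0) by apply: (subspaceB s0); [apply: (r_parc _).1|apply: (subspaceZ s0)].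
  have O : rod S (rc S v1 - mu *: v1) by apply: (subspaceB s1); [apply: (r_parc _).2|apply: (subspaceZ s1)].
  by move=> /(homog_sum0 E O)[/eqP h1 /eqP h2]; move: h1 h2; rewrite !subr_eq0 => /eqP h1 /eqP h2.
have [v [cv vn hv]] := homog_nonzero kh cu un.
apply: ns; exists mu; apply: (simple_generates (P := fun u => rc S u = mu *: u) simS vn hv) => //.
split.
- split; first by rewrite (linP0 clin) scaler0.
  by move=> a y z ey ez; rewrite clin ey ez scalerDr !scalerA mulrC.
- by move=> p m y ey; rewrite -[aX A p m y]/(rX p m y) rCX ey (linPZ (@rX_lin F S p m)).
- by move=> y ey; rewrite -[aC A y]/(rc S y) {1}ey (linPZ clin).
Qed.

(** * Level zero: highest weight vectors *)

Section LevelZero.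
Variables (l : F).
Hypothesis cl : forall v : S, rc S v = l *: v.
Local Notation X := (@rX F S).
Local Notation G0 := (rG S 0).
Local Notation Glin := (@r_linG F S 0).

(** This is [l / 24], since [zGG F 0 0] is [- 1 / 12]. *)
Definition shift : F := - (2%:R^-1 * (zGG F 0 0 * l)).

Lemma L0_G0 v : rL S 0 v = G0 (G0 v) + shift *: v.
Proof.
have := @r_GG F S 0 0 v; rewrite cl scalerA -mulr2n -scaler_nat => /(congr1 (fun z => 2%:R^-1 *: z)).
rewrite scalerA mulVf ?pnatr_eq0 // scale1r => ->.
by rewrite scalerDr !scalerA mulVf ?pnatr_eq0 // scale1r addr0 /shift scaleNr addrK.
Qed.

(** An eigenvector of the odd operator [G_0] need not be homogeneous. Its homogeneous components are
    still eigenvectors of the even operator [L_0], and a nonzero one generates [S]. *)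
Lemma eigenvector_highest_weight (u : S) (mu : F) :
  killed 0 u -> u != 0 -> G0 u = mu *: u -> highest_weight S.
Proof.
move=> ku u0 gu.
have Lu : rL S 0 u = (mu * mu + shift) *: u.
  by rewrite L0_G0 gu (linPZ Glin) gu scalerA scalerDl.
pose P v := killed 0 v /\ rL S 0 v = (mu * mu + shift) *: v.
have [||v [[kv Lv] v0 hv]] := @homog_nonzero P u _ _ u0; last 2 first.
- by split.
- exists v; split=> //.
  + move=> Q sQ QX QC Qv; apply: (simple_generates simS v0 hv) => //.
    by apply/stable_rL_rG; split.
  + by move=> m m0; split; [apply: (kv false)|apply: (kv true)].
  + by exists (mu * mu + shift), l.
move=> v0 v1 e0 o1 [k01 L01]; have [k0 k1] := killed_homog e0 o1 k01.
set la := mu * mu + shift in L01 *.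
have [s0 s1 _ _] := r_grading S.
have E : rev S (rL S 0 v0 - la *: v0) by apply: (subspaceB s0); [apply: (r_parL _ _).1|apply: (subspaceZ s0)].
have O : rod S (rL S 0 v1 - la *: v1) by apply: (subspaceB s1); [apply: (r_parL _ _).2|apply: (subspaceZ s1)].
have : (rL S 0 v0 - la *: v0) + (rL S 0 v1 - la *: v1) = 0.
  by rewrite addrACA -opprD -scalerDr -(linPD (@r_linL F S 0)) [X in X - _]L01 subrr.
by move=> /(homog_sum0 E O)[/eqP h1 /eqP h2]; move: h1 h2; rewrite !subr_eq0 => /eqP h1 /eqP h2.
Qed.

Section NoEigenvector.
Hypothesis noeig : forall u mu, killed 0 u -> u != 0 -> G0 u <> mu *: u.
Variable w : S.
Hypotheses (kw : killed 0 w) (w0 : w != 0).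

Local Notation ev p := (peval G0 p w).

Lemma killed_ev p : killed 0 (ev p).
Proof.
apply: (@peval_stable _ _ _ (@killed F S 0)) => //; first exact: killed_subspace.
by move=> u ku; apply: (@killed_nonneg _ _ _ true 0).
Qed.

Lemma ev_eq0 p : ev p = 0 -> p = 0.
Proof.
move=> e; apply/eqP/negP => /negP p0.
have [|mu [u [ku u0 gu]]] := peval_eigen Glin (killed_subspace S 0) _ kw w0 p0 e.
  by move=> u ku; apply: (@killed_nonneg _ _ _ true 0).
exact: noeig gu.
Qed.

Lemma ev_inj p q : ev p = ev q -> p = q.
Proof.
move=> e; apply/eqP; rewrite -subr_eq0; apply/eqP; apply: ev_eq0.
by rewrite (linPB (peval_linl _ w)) e subrr.
Qed.

(** Degree at most [e] in [G_0], expressed by coefficients so that a negative [e] gives the zero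
    space. *)
Definition Wfilt (e : int) (v : S) := exists p : {poly F}, (forall i : nat, e < i%:Z -> p`_i = 0) /\ v = ev p.

Lemma G0_ev p : G0 (ev p) = ev ('X * p). Proof. by rewrite (pevalXM Glin). Qed.

Lemma L0_ev p : rL S 0 (ev p) = ev ('X * ('X * p) + shift *: p).
Proof.
by rewrite L0_G0 !G0_ev (linPD (peval_linl _ w)) (linPZ (peval_linl _ w)).
Qed.

Lemma Wfilt_subspace e : subspace (Wfilt e).
Proof.
split; first by exists 0; split=> [i _|]; [rewrite coef0|rewrite (linP0 (peval_linl _ w))].
move=> a _ _ [p [Hp ->]] [q [Hq ->]]; exists (a *: p + q); split; last by rewrite peval_linl.
by move=> i ei; rewrite coefD coefZ Hp // Hq // mulr0 addr0.
Qed.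

Lemma Wfilt_mono e e' v : e <= e' -> Wfilt e v -> Wfilt e' v.
Proof. by move=> ee' [p [Hp ->]]; exists p; split=> // i ei; apply: Hp; lia. Qed.

Lemma Wfilt_neg e v : e < 0 -> Wfilt e v -> v = 0.
Proof.
move=> e0 [p [Hp ->]]; have -> : p = 0 by apply/polyP => i; rewrite coef0 Hp //; lia.
by rewrite (linP0 (peval_linl _ w)).
Qed.

Lemma Wfilt_X p m e v : 0 <= m -> m <= 0%N%:Z -> Wfilt e v -> Wfilt (e + gw 0 p m) (X p m v).
Proof.
move=> m0 m1 [q [Hq ->]]; have -> : m = 0 by lia.
rewrite /gw; case: p => /=.
  rewrite G0_ev; exists ('X * q); split=> // -[|i] ei; rewrite coefXM //=; apply: Hq; lia.
rewrite L0_ev; exists ('X * ('X * q) + shift *: q); split=> // i ei.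
rewrite coefD coefZ !coefXM (Hq i); last by lia.
rewrite mulr0 addr0; case: i ei => [|[|i]] ei //=; apply: Hq; lia.
Qed.

Lemma Wfilt_X0 p m e v : 0%N%:Z < m -> Wfilt e v -> X p m v = 0.
Proof. by move=> m0 [q [_ ->]]; apply: killed_ev. Qed.

Lemma Wfilt_C e v : Wfilt e v -> Wfilt e (rc S v).
Proof. by rewrite cl; apply: (subspaceZ (Wfilt_subspace e)). Qed.

(** On polynomials in [G_0], [L_0] is multiplication by [X ^ 2 + shift], which raises the degree by
    exactly [tau 0 = 2]. *)
Lemma Wfilt_inj e v : Wfilt e v -> Wfilt (e + tau 0 - 1) (X false 0%N%:Z v) -> Wfilt (e - 1) v.
Proof.
move=> [p [Hp ->]] [q [Hq]]; rewrite -[X _ _ _]/(rL S 0 (ev p)) L0_ev => /ev_inj epq.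
exists p; split=> // i ei.
have := congr1 (fun r : {poly F} => r`_i.+2) epq.
rewrite coefD coefZ !coefXM /= (Hp i.+2); last by lia.
rewrite mulr0 addr0 => ->; apply: Hq; rewrite /tau /=; lia.
Qed.

Lemma ev_exhausted p : exhausted Wfilt (ev p).
Proof.
by exists (size p)%:Z, p; split=> // i; rewrite ltz_nat => /ltnW; apply: nth_default.
Qed.

(** The multiples of [G_0] in the polynomials applied to [w] form a [b]-stable space containing
    [G_0 w], which is nonzero. Simplicity and [sspan_cap] put [w] into it, so [X] would divide
    [1]. *)
Lemma no_eigenvector_absurd : rev S w \/ rod S w -> False.
Proof.
move=> hw; pose U (z : S) := exists p : {poly F}, p`_0 = 0 /\ z = ev p.
have sU : subspace U.
  split; first by exists 0; rewrite coef0 (linP0 (peval_linl _ w)).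
  move=> a _ _ [p [p0 ->]] [q [q0 ->]]; exists (a *: p + q).
  by rewrite coefD coefZ p0 q0 mulr0 addr0 peval_linl.
have UX p m z : 0 <= m -> U z -> U (aX A p m z).
  move=> m0 [q [q0 ->]]; have [->|m1] := eqVneq m 0; last first.
    by rewrite [aX _ _ _ _]killed_ev; [case: sU|lia].
  case: p; last first.
    exists ('X * ('X * q) + shift *: q); split; last exact: L0_ev.
    by rewrite coefD coefZ q0 mulr0 addr0 coefXM.
  by exists ('X * q); rewrite -G0_ev coefXM.
have UC z : U z -> U (aC A z) by rewrite /= cl; apply: (subspaceZ sU).
have g0 : G0 w != 0.
  by apply/eqP => g0; apply: (noeig (mu := 0) kw w0); rewrite scale0r.
have hg : rev S (G0 w) \/ rod S (G0 w).
  by case: hw => h; [right; apply: (r_parG _ _).1|left; apply: (r_parG _ _).2].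
have Ug : U (G0 w).
  by exists 'X; rewrite coefX -['X]mulr1 (pevalXM Glin) peval1.
have allU : sspan A U w.
  apply: (simple_generates simS g0 hg (sspan_stable UX UC)).
  exact: (@wspan_incl _ _ _ _ (sorted nle) [::]).
have [p [p0 ew]] : U w.
  apply: (sspan_cap (A:=A) Wfilt_subspace Wfilt_mono Wfilt_neg Wfilt_X Wfilt_X0 Wfilt_C Wfilt_inj sU _ _ allU).
    by move=> _ [p [_ ->]]; apply: ev_exhausted.
  by rewrite -[w](peval1 G0); apply: ev_exhausted.
have e1 : p = 1 by apply: ev_inj; rewrite -ew peval1.
by move: p0; rewrite e1 coef1 => /eqP; rewrite oner_eq0.
Qed.
End NoEigenvector.

Lemma level_zero : (exists v : S, v != 0 /\ killed 0 v) -> highest_weight S.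
Proof.
move=> [v [v0 kv]]; apply: contrapT => nhw.
have [w [kw w0 hw]] := homog_nonzero (@killed_homog F S 0) kv v0.
apply: (@no_eigenvector_absurd _ w kw w0 hw) => u mu ku u0 gu; apply: nhw.
exact: (@eigenvector_highest_weight u mu).
Qed.
End LevelZero.

(** * From smoothness to the two types of modules, and back to local finiteness *)

Lemma smooth_induced_or_highest_weight : smooth S -> highest_weight S \/
  exists (V : BMod F) (M : RMod F) (iota : V -> M),
    [/\ b_simple V, exists t : nat, [/\ (0 < t)%N, injective (bL V t) &
          forall i : nat, (t < i)%N -> forall v, bL V i v = 0],
        is_induced iota & r_iso S M].
Proof.
move=> /smoothE sm; have [x x0] := simS.1.
pose level n := `[< exists v : S, v != 0 /\ killed n v >].
have ex_level : exists n, level n.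
  by have [n kx] := sm x; exists n; apply/asboolP; exists x.
case: (ex_minnP ex_level) => -[|t] /asboolP Ht tmin.
  by left; have [l cl] := central_scalar; apply: level_zero cl Ht.
right; apply: (positive_level simS (ltn0Sn t) Ht) => v kv Lv.
(* By minimality of the level, [L_(t+1)] and [G_(t+1)] have no common kernel on the killed space. If
   [L_(t+1) v = 0], both kill [G_(t+1) v], so this vector is zero, and then so is [v]. *)
have kt u : killed t.+1 u -> rL S t.+1%:Z u = 0 -> rG S t.+1%:Z u = 0 -> u = 0.
  move=> ku Lu Gu; apply/eqP/negP => /negP u0.
  suff /tmin : level t by rewrite ltnn.
  apply/asboolP; exists u; split=> // p m tm.
  have [->|mt] := eqVneq m t.+1%:Z; first by case: p.
  by apply: ku; lia.
apply: (kt _ kv Lv); apply: (kt _).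
- exact: (@killed_nonneg _ _ _ true).
- rewrite -[LHS]/(rX false t.+1%:Z (rX true t.+1%:Z v)) -Lt_Gt //.
  by rewrite [X in rX true _ X]Lv (linP0 (@rX_lin F S true _)).
- exact: Gt_sqr.
Qed.

Lemma induced_or_highest_weight_locally_finite :
  (highest_weight S \/
  exists (V : BMod F) (M : RMod F) (iota : V -> M),
    [/\ b_simple V, exists t : nat, [/\ (0 < t)%N, injective (bL V t) &
          forall i : nat, (t < i)%N -> forall v, bL V i v = 0],
        is_induced iota & r_iso S M]) ->
  exists t : nat, (0 < t)%N /\ locally_finite (rL S t%:Z).
Proof.
case=> [[w [w0 gen kw _]]|[V [M [iota [_ [t [t0 _ Lt]] [[ilin ipar iX iC] univ] [h [[hlin hpar hX hC] [g hg gh]]]]]]]].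
  apply: (@killed_generator_locally_finite _ _ w 0) => [P /stable_rL_rG[sP PX PC] Pw|p m m0].
    exact: gen.
  by case: p; [apply: (kw m m0).2|apply: (kw m m0).1].
have glin : linear g.
  by move=> a u v; apply: (can_inj hg); rewrite gh hlin !gh.
have gX m v : g (rL M m v) = rL S m (g v) /\ g (rG M m v) = rG S m (g v).
  by split; apply: (can_inj hg); rewrite gh ?(hX m _).1 ?(hX m _).2 gh.
have [s0 s1 dec uni] := r_grading S; have [m0 m1 mdec muni] := r_grading M.
have gpar v : (rev M v -> rev S (g v)) /\ (rod M v -> rod S (g v)).
  have [v0 [v1 [e0 o1 ev]]] := dec (g v).
  have ev' : v = h v0 + h v1 by rewrite -(linPD hlin) -ev gh.
  have he := (hpar v0).1 e0; have ho := (hpar v1).2 o1; split=> hv.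
  - have h1 : h v1 = 0.
      by apply: muni => //; rewrite -[h v1](addKr (h v0)) -ev'; apply: (subspaceD m0) => //; apply: (subspaceN m0).
    by rewrite ev -[v1]hg h1 (linP0 glin) addr0.
  - have h0 : h v0 = 0.
      by apply: muni => //; rewrite -[h v0](addrK (h v1)) -ev'; apply: (subspaceB m1).
    by rewrite ev -[v0]hg h0 (linP0 glin) add0r.
(* If [iota] were zero, both the identity and the zero map of [M] would extend the zero map on [V];
   by uniqueness [M], hence [S], would vanish. *)
have [v iv] : exists v, iota v <> 0.
  apply: contrapT => H; have i0 v : iota v = 0 by apply: contrapT => iv; apply: H; exists v.
  have [x x0] := simS.1.
  have zero_hom : b_hom (fun _ : V => 0 : M).
    split=> [a u v|v|m v|v].
    + by rewrite scaler0 addr0.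
    + by split=> _; [case: m0|case: m1].
    + by rewrite (linP0 (@r_linL F M m)) (linP0 (@r_linG F M m)).
    + by rewrite (linP0 (@r_linc F M)).
  have [k [_ _ kuniq]] := univ M _ zero_hom.
  have idk : forall x, x = k x by apply: (kuniq id) => //; split.
  have zk : forall x, 0 = k x.
    apply: (kuniq (fun _ => 0)) => //; split=> [a u v|y|m y|y].
    + by rewrite scaler0 addr0.
    + by split=> _; [case: m0|case: m1].
    + by rewrite (linP0 (@r_linL F M m)) (linP0 (@r_linG F M m)).
    + by rewrite (linP0 (@r_linc F M)).
  by move: x0; rewrite -[x]hg [h x]idk -zk (linP0 glin) eqxx.
(* The bracket of [L_m] with [G_0] is [(m / 2) G_m], so [G_m] vanishes along with [L_m]. *)
have Gt (m : nat) u : (t < m)%N -> bG V m u = 0.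
  move=> tm; have := @b_LG F V m 0%N u; rewrite addn0.
  rewrite !Lt // (linP0 (@b_linG F V 0%N)) subrr => /esym/eqP.
  rewrite scaler_eq0 => /orP[|/eqP //]; rewrite /cLG mulr0z subr0 mulf_eq0 invr_eq0 !pnatr_eq0; lia.
have kg u : killed t (g (iota u)).
  move=> p [m|m] tm; last by lia.
  have tm' : (t < m)%N by lia.
  have [iL iG] := iX m u; have [gL gG] := gX m (iota u).
  by case: p; rewrite /= -?gL -?gG -?iL -?iG ?Lt ?Gt // (linP0 ilin) (linP0 glin).
have gi0 u : iota u <> 0 -> g (iota u) != 0.
  by move=> iu; apply/eqP => e; apply: iu; rewrite -[iota u]gh e (linP0 hlin).
have [y [y0 hy ky]] : exists y : S, [/\ y != 0, rev S y \/ rod S y & killed t y].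
  have [_ _ bdec _] := b_grading V; have [v0 [v1 [e0 o1 ev]]] := bdec v.
  have [z|z] := pselect (iota v0 = 0).
    exists (g (iota v1)); split=> //; last by right; apply: (gpar _).2; apply: (ipar _).2.
    by apply: gi0 => z1; apply: iv; rewrite ev (linPD ilin) z z1 addr0.
  exists (g (iota v0)); split=> //; first exact: gi0.
  by left; apply: (gpar _).1; apply: (ipar _).1.
apply: (@killed_generator_locally_finite _ _ y t) => // P stP Py.
exact: (simple_generates simS y0 hy).
Qed.

End CentralCharacter.

(** If [h] had only finite fibres on the reals, the interval [[0, 1]] would be countable, against
    its Lebesgue measure [1]. *)
Lemma uncountable_fiber (R : realType) (h : R[i] -> nat) : exists n, forall k, exists s : seq R[i],
  [/\ uniq s, size s = k & forall z, z \in s -> h z = n].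
Proof.
pose A n := [set r : R | h r%:C%C = n]%classic.
have [[n infA]|finA] := pselect (exists n, infinite_set (A n)).
  exists n => k; have [B BA kB] := infinite_set_fset k infA.
  exists (take k [seq r%:C%C | r <- finmap.enum_fset B]); split.
  - by apply: take_uniq; rewrite map_inj_uniq ?finmap.fset_uniq // => x y [].
  - by rewrite size_take size_map; case: ltngtP kB.
  - by move=> z /mem_take /mapP[r rB ->]; apply: (BA r).
have cA : countable (\bigcup_(n in [set: nat]) A n)%classic.
  apply: bigcup_countable => // n _; apply: finite_set_countable.
  by apply: contrapT => infA; apply: finA; exists n.
have c01 : countable (`[0, 1]%classic : set R).
  by apply: sub_countable cA; apply: subset_card_le => r _; exists (h r%:C%C).
have := countable_lebesgue_measure0 c01; rewrite lebesgue_measure_itv.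
by rewrite /= lte_fin ltr01 sube0 => /eqP; rewrite eqe oner_eq0.
Qed.

(* The ground field is C = R[i] for R : realType (a model of the reals). *)
Theorem theorem4p3 (R : realType) (S : RMod R[i]) :
  r_simple S ->
  [<-> (exists t : nat, (0 < t)%N /\ locally_finite (rL S t%:Z));
       smooth S;
       highest_weight S \/
       exists (V : BMod R[i]) (M : RMod R[i]) (iota : V -> M),
         [/\ b_simple V,
             exists t : nat, [/\ (0 < t)%N, injective (bL V t) &
                                 forall i : nat, (t < i)%N -> forall v, bL V i v = 0],
             is_induced iota &
             r_iso S M]].
Proof.
move=> simS; split; [|split].
- by move=> [t [t0 lf]]; apply: locally_finite_smooth lf simS.
- exact: smooth_induced_or_highest_weight (@uncountable_fiber R).
- exact: induced_or_highest_weight_locally_finite.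
Qed.
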